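(* Let $k$ be a field, $n \ge 3$, and let $G$ be a simple graph on the vertex set $\{1,\dots,n\}$. Then $I_G^{(2)}$ is a Cohen-Macaulay ideal if and only if $\operatorname{diam}(G) \le 2$.
   Context: Let $S = k[x_1,\dots,x_n]$ be a polynomial ring. A simple graph here means a finite undirected graph without multiple edges, without loops and without isolated vertices (every vertex in $\{1,\dots,n\}$ belongs to an edge). We write $\{i,j\}\in G$ if $\{i,j\}$ is an edge of $G$. For $i \ne j$ put $P_{ij} = (x_t \mid t \ne i,j)$, the prime ideal of $S$ generated by all variables other than $x_i,x_j$. Define $I_G = \bigcap_{\{i,j\}\in G} P_{ij}$ and its $m$-th symbolic power $I_G^{(m)} = \bigcap_{\{i,j\}\in G} P_{ij}^m$. An ideal $I$ of $S$ is called Cohen-Macaulay if $S/I$ is a Cohen-Macaulay ring. The distance between two vertices of $G$ is the minimal length (number of edges) of a path between them, infinite if there is no such path; $\operatorname{diam}(G)$ is the maximal distance between two vertices of $G$. *)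

(* Defs.v *)
From HB Require Import structures.
From mathcomp Require Import mpoly.
From mathcomp Require Import all_boot all_order all_algebra.
From mathcomp Require Import generic_quotient ring_quotient.
From mathcomp Require Import boolp classical_sets.
From mathcomp Require Import ring.

Set Implicit Arguments.
Unset Strict Implicit.
Unset Printing Implicit Defensive.

Import GRing.Theory.
Local Open Scope ring_scope.
Local Open Scope classical_set_scope.
Local Open Scope quotient_scope.

Section GeneratedIdeals.
Variable R : comNzRingType.

Definition ideal_gen (A : set R) : set R :=
  [set x | exists s : seq (R * R),
     (forall p, p \in s -> A p.2) /\ x = \sum_(p <- s) p.1 * p.2].

Definition ideal_pow (I : set R) (m : nat) : set R :=
  ideal_gen [set x | exists f : 'I_m -> R,
     (forall i, I (f i)) /\ x = \prod_(i < m) f i].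

End GeneratedIdeals.

(* The localization of R at the prime ideal P: fractions x.1 / x.2 with x.2   *)
(* outside P, where a / s = b / t iff u (a t - b s) = 0 for some u outside P. *)
(* R may have zero divisors, so the fraction field of the library does not    *)
(* apply.                                                                     *)
Module Localization.
Section Localization.
Variables (R : comNzRingType) (P : prime_idealr R).

Definition den := {s : R | s \notin (P : pred R)}.
Definition frac : Type := (R * den)%type.
#[export] HB.instance Definition _ := Choice.on frac.

Lemma one_notin : (1 : R) \notin (P : pred R).
Proof. by rewrite idealr1. Qed.

Lemma mul_notin (s t : den) : sval s * sval t \notin (P : pred R).
Proof. by rewrite prime_idealrM negb_or (valP s) (valP t). Qed.

Definition den1 : den := exist _ 1 one_notin.
Definition denM (s t : den) : den := exist _ (sval s * sval t) (mul_notin s t).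

Definition equiv (x y : frac) : bool :=
  `[< exists u : den, sval u * (x.1 * sval y.2 - y.1 * sval x.2) = 0 >].

Lemma equivP (x y : frac) :
  reflect (exists u : den, sval u * (x.1 * sval y.2) = sval u * (y.1 * sval x.2))
          (equiv x y).
Proof.
apply: (iffP (asboolP _)) => -[u hu]; exists u.
  by apply/eqP; rewrite -subr_eq0 -mulrBr hu.
by rewrite mulrBr hu subrr.
Qed.

Lemma equiv_refl : reflexive equiv.
Proof. by move=> x; apply/equivP; exists den1. Qed.

Lemma equiv_sym : symmetric equiv.
Proof. by move=> x y; apply/equivP/equivP => -[u hu]; exists u. Qed.

Lemma equiv_trans : transitive equiv.
Proof.
move=> y x z /equivP[u hu] /equivP[v hv]; apply/equivP.
exists (denM (denM u v) y.2); rewrite /=.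
transitivity (sval v * sval z.2 * (sval u * (x.1 * sval y.2))); first by ring.
rewrite hu.
transitivity (sval u * sval x.2 * (sval v * (y.1 * sval z.2))); first by ring.
by rewrite hv; ring.
Qed.

Canonical equiv_equiv := EquivRel equiv equiv_refl equiv_sym equiv_trans.

Definition type := {eq_quot equiv}.
#[export] HB.instance Definition _ : EqQuotient frac equiv type := EqQuotient.on type.
#[export] HB.instance Definition _ := Choice.on type.

Lemma equiv_repr (x : frac) : exists u : den,
  sval u * (x.1 * sval (repr (\pi_type x)).2)
  = sval u * ((repr (\pi_type x)).1 * sval x.2).
Proof. by apply/equivP; rewrite -[equiv _ _]eqmodE reprK. Qed.

Definition addf (x y : frac) : frac :=
  (x.1 * sval y.2 + y.1 * sval x.2, denM x.2 y.2).
Definition oppf (x : frac) : frac := (- x.1, x.2).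
Definition mulf (x y : frac) : frac := (x.1 * y.1, denM x.2 y.2).

Definition zero : type := lift_cst type (0, den1).
Definition one : type := lift_cst type (1, den1).
Definition add := lift_op2 type addf.
Definition opp := lift_op1 type oppf.
Definition mul := lift_op2 type mulf.
Definition tofrac := lift_embed type (fun x : R => (x, den1) : frac).

Canonical pi_zero_morph := PiConst zero.
Canonical pi_one_morph := PiConst one.
Canonical tofrac_pi_morph := PiEmbed tofrac.

Lemma pi_add : {morph \pi : x y / addf x y >-> add x y}.
Proof.
move=> x y; unlock add; apply/eqmodP/equivP; rewrite /=.
have [u hu] := equiv_repr x; have [v hv] := equiv_repr y.
move: (repr (\pi x)) (repr (\pi y)) hu hv => x' y' hu hv.
exists (denM u v); rewrite /=.
transitivity (sval v * sval y.2 * sval y'.2 * (sval u * (x.1 * sval x'.2))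
            + sval u * sval x.2 * sval x'.2 * (sval v * (y.1 * sval y'.2))).
  by ring.
by rewrite hu hv; ring.
Qed.
Canonical pi_add_morph := PiMorph2 pi_add.

Lemma pi_opp : {morph \pi : x / oppf x >-> opp x}.
Proof.
move=> x; unlock opp; apply/eqmodP/equivP; rewrite /=.
have [u hu] := equiv_repr x; exists u.
by rewrite !mulNr !mulrN hu.
Qed.
Canonical pi_opp_morph := PiMorph1 pi_opp.

Lemma pi_mul : {morph \pi : x y / mulf x y >-> mul x y}.
Proof.
move=> x y; unlock mul; apply/eqmodP/equivP; rewrite /=.
have [u hu] := equiv_repr x; have [v hv] := equiv_repr y.
move: (repr (\pi x)) (repr (\pi y)) hu hv => x' y' hu hv.
exists (denM u v); rewrite /=.
transitivity ((sval u * (x.1 * sval x'.2)) * (sval v * (y.1 * sval y'.2))).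
  by ring.
by rewrite hu hv; ring.
Qed.
Canonical pi_mul_morph := PiMorph2 pi_mul.

Lemma addA : associative add.
Proof.
elim/quotW=> x; elim/quotW=> y; elim/quotW=> z; rewrite !piE.
by apply/eqmodP/equivP; exists den1; rewrite /=; ring.
Qed.

Lemma addC : commutative add.
Proof.
elim/quotW=> x; elim/quotW=> y; rewrite !piE.
by apply/eqmodP/equivP; exists den1; rewrite /=; ring.
Qed.

Lemma add0 : left_id zero add.
Proof.
elim/quotW=> x; rewrite !piE.
by apply/eqmodP/equivP; exists den1; rewrite /=; ring.
Qed.

Lemma addN : left_inverse zero opp add.
Proof.
elim/quotW=> x; rewrite !piE.
by apply/eqmodP/equivP; exists den1; rewrite /=; ring.
Qed.

#[export] HB.instance Definition _ := GRing.isZmodule.Build type addA addC add0 addN.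

Lemma mulA : associative mul.
Proof.
elim/quotW=> x; elim/quotW=> y; elim/quotW=> z; rewrite !piE.
by apply/eqmodP/equivP; exists den1; rewrite /=; ring.
Qed.

Lemma mulC : commutative mul.
Proof.
elim/quotW=> x; elim/quotW=> y; rewrite !piE.
by apply/eqmodP/equivP; exists den1; rewrite /=; ring.
Qed.

Lemma mul1 : left_id one mul.
Proof.
elim/quotW=> x; rewrite !piE.
by apply/eqmodP/equivP; exists den1; rewrite /=; ring.
Qed.

Lemma mulDl : left_distributive mul add.
Proof.
elim/quotW=> x; elim/quotW=> y; elim/quotW=> z; rewrite !piE.
by apply/eqmodP/equivP; exists den1; rewrite /=; ring.
Qed.

Lemma one_neq0 : one != zero.
Proof.
rewrite piE; apply/equivP => -[[u uP]]; rewrite /= mul0r mulr0 !mulr1 => u0.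
by move: uP; rewrite u0 idealr0.
Qed.

#[export] HB.instance Definition _ :=
  GRing.Zmodule_isComNzRing.Build type mulA mulC mul1 mulDl one_neq0.

End Localization.
Module Exports. HB.reexport. End Exports.
End Localization.
Export Localization.Exports.

Notation localization P := (@Localization.type _ P).

Section CohenMacaulay.
Variable R : comNzRingType.

(* All the ideals in an [idealr R] are proper by definition, which is         *)
(* harmless here since the unit ideal is generated by 1.                      *)
Definition noetherian : Prop :=
  forall I : idealr R, exists s : seq R,
    [set x | x \in (I : pred R)] = ideal_gen [set x | x \in s].

Definition maximal_ideal (M : idealr R) : Prop :=
  forall J : idealr R,
    {subset (M : pred R) <= (J : pred R)} ->
    {subset (J : pred R) <= (M : pred R)}.

Definition local_ring (M : idealr R) : Prop :=
  maximal_ideal M /\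
  forall M' : idealr R, maximal_ideal M' ->
    (M' : pred R) =i (M : pred R).

(* A strictly increasing chain p 0 < ... < p d; the other values of p are     *)
(* irrelevant.                                                                *)
Definition prime_chain (p : nat -> prime_idealr R) (d : nat) : Prop :=
  forall i, (i < d)%N ->
    [set x | x \in (p i : pred R)] `<` [set x | x \in (p i.+1 : pred R)].

Definition krull_dim_eq (d : nat) : Prop :=
  (exists p, prime_chain p d) /\
  forall p d', prime_chain p d' -> (d' <= d)%N.

Definition regular_sequence (s : seq R) : Prop :=
  (forall i, (i < size s)%N -> forall b,
     ideal_gen [set x | x \in take i s] (s`_i * b) ->
     ideal_gen [set x | x \in take i s] b) /\
  ~ ideal_gen [set x | x \in s] 1.

Definition regular_sequence_in (M : idealr R) (s : seq R) : Prop :=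
  regular_sequence s /\ {subset s <= (M : pred R)}.

Definition depth_eq (M : idealr R) (d : nat) : Prop :=
  (exists s, regular_sequence_in M s /\ size s = d) /\
  forall s, regular_sequence_in M s -> (size s <= d)%N.

Definition cohen_macaulay_local : Prop :=
  noetherian /\
  exists M : idealr R, local_ring M /\
    exists d : nat, depth_eq M d /\ krull_dim_eq d.

End CohenMacaulay.

Arguments noetherian : clear implicits.
Arguments cohen_macaulay_local : clear implicits.

Definition cohen_macaulay (R : comNzRingType) : Prop :=
  noetherian R /\
  forall M : prime_idealr R, maximal_ideal M ->
    cohen_macaulay_local (localization M).

(* J is I itself, bundled with the proof that it is a proper ideal, which the *)
(* quotient ring construction of the library requires.                        *)
Definition cohen_macaulay_ideal (R : comNzRingType) (I : set R) : Prop :=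
  exists J : idealr R,
    [set x | x \in (J : pred R)] = I /\ cohen_macaulay {ideal_quot J}.

Section Graphs.
Variable n : nat.

Definition simple_graph (G : rel 'I_n) : Prop :=
  [/\ symmetric G, irreflexive G & forall i, exists j, G i j].

Definition has_path (G : rel 'I_n) (i j : 'I_n) (d : nat) : bool :=
  [exists p : d.-tuple 'I_n,
     [&& path G i p, uniq (i :: p) & last i p == j]].

(* Distances and diameters take values in option nat, None standing for       *)
(* infinity.                                                                  *)
Definition distance (G : rel 'I_n) (i j : 'I_n) : option nat :=
  match pselect (exists d, has_path G i j d) with
  | left h => Some (ex_minn h)
  | right _ => None
  end.

Definition diam (G : rel 'I_n) : option nat :=
  if [forall i, forall j, distance G i j != None]
  then Some (\max_(i < n) \max_(j < n) odflt 0%N (distance G i j))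
  else None.

Definition xnat_le (x : option nat) (m : nat) : bool :=
  if x is Some d then (d <= m)%N else false.

Variable k : fieldType.

(* P_ij, in the variables 'X_0, ..., 'X_(n-1). *)
Definition edge_prime (i j : 'I_n) : set {mpoly k[n]} :=
  ideal_gen [set f | exists t : 'I_n, [/\ t != i, t != j & f = 'X_t]].

Definition symbolic_power (G : rel 'I_n) (m : nat) : set {mpoly k[n]} :=
  \bigcap_(e in [set e : 'I_n * 'I_n | G e.1 e.2])
    ideal_pow (edge_prime e.1 e.2) m.

End Graphs.

Arguments edge_prime {n} k i j.
Arguments symbolic_power {n} k G m.

(* Main.v *)
(* Idea. For an edge e write P_e for its prime. An element of S lies in P_e^2 *)
(* iff each of its monomials has degree at least 2 in the variables off e, so *)
(* S / I_G^(2) embeds in the product of the rings S / P_e^2. If diam G <= 2,  *)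
(* then for every monomial x^a the edges e with x^a outside P_e^2 form a      *)
(* connected graph, so a family (d_e) comes from S / I_G^(2) as soon as d_e   *)
(* and d_e' agree in S / (P_e^2 + P_e'^2) whenever e and e' meet. A pair f, g *)
(* that is regular on every S / P_e^2, with f regular on those S / (P_e^2 +   *)
(* P_e'^2), is therefore regular on S / I_G^(2). Such a pair exists in every  *)
(* maximal ideal: f = phi(sum x_t) and g = psi(sum_(t < u) x_t x_u) with phi  *)
(* and psi monic, given by the Nullstellensatz. Since all local rings have    *)
(* dimension at most 2, S / I_G^(2) is Cohen-Macaulay.                        *)
(* Conversely, if s and t are neither equal, nor adjacent, nor joined by a    *)
(* common neighbour, the edges at s and those at t are disjoint components    *)
(* for the monomial x_s x_t; the section equal to x_s x_t on the edges at s   *)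
(* and to 0 on the other edges is multiplied into S / I_G^(2) by every        *)
(* variable, but is not a fraction. It prevents a regular sequence of length  *)
(* 2 at the origin, although the dimension there is 2.                        *)

From HB Require Import structures.
Require Import Defs.
From mathcomp Require Import mpoly.
From mathcomp Require Import all_boot all_order all_algebra.
From mathcomp Require Import generic_quotient ring_quotient.
From mathcomp Require Import boolp classical_sets.
From mathcomp Require Import ring zify.

Set Implicit Arguments.
Unset Strict Implicit.
Unset Printing Implicit Defensive.

Import GRing.Theory.
Local Open Scope ring_scope.
Local Open Scope classical_set_scope.
Local Open Scope quotient_scope.

(** * Ideals and chains of primes *)

Section Ideals.
Variable R : comNzRingType.
Implicit Types (I J A T : set R) (a b x y z : R) (s : seq R).

(** Ideals as plain sets, with the unit ideal allowed: an [idealr] is proper by definition, which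
    sums and extensions of ideals need not be. *)
Definition is_ideal I : Prop :=
  [/\ I 0, forall x y, I x -> I y -> I (x + y) & forall a x, I x -> I (a * x)].

Lemma is_idealN I x : is_ideal I -> I x -> I (- x).
Proof. by case=> _ _ hM hx; rewrite -[- x]mulN1r; exact: hM. Qed.

Lemma is_idealB I x y : is_ideal I -> I x -> I y -> I (x - y).
Proof. by move=> hI hx hy; case: (hI) => _ hD _; apply: hD => //; apply: is_idealN. Qed.

Lemma is_ideal_sum I (K : eqType) (r : seq K) (F : K -> R) :
  is_ideal I -> (forall i, i \in r -> I (F i)) -> I (\sum_(i <- r) F i).
Proof.
move=> [h0 hD _] h; rewrite big_seq.
by apply: (big_ind I).
Qed.

Lemma is_ideal_sum_cond I (K : finType) (P : pred K) (F : K -> R) :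
  is_ideal I -> (forall i, P i -> I (F i)) -> I (\sum_(i | P i) F i).
Proof. by move=> [h0 hD _] h; apply: (big_ind I). Qed.

Lemma is_ideal_gen A : is_ideal (ideal_gen A).
Proof.
split.
- by exists [::]; split => //; rewrite big_nil.
- move=> x y [s [hs ->]] [t [ht ->]]; exists (s ++ t); split; last by rewrite big_cat.
  by move=> p; rewrite mem_cat => /orP[]; [apply: hs|apply: ht].
- move=> a x [s [hs ->]]; exists [seq (a * p.1, p.2) | p <- s]; split.
    by move=> p /mapP[q /hs hq ->].
  by rewrite big_map mulr_sumr; apply: eq_bigr => p _; rewrite mulrA.
Qed.

Lemma ideal_gen_in A x : A x -> ideal_gen A x.
Proof.
move=> hx; exists [:: (1, x)]; split; last by rewrite big_seq1 mul1r.
by move=> p; rewrite inE => /eqP ->.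
Qed.

Lemma ideal_gen_min A I : is_ideal I -> A `<=` I -> ideal_gen A `<=` I.
Proof.
move=> hI hA x [s [hs ->]]; apply: is_ideal_sum => // p /hs /hA h.
by case: hI => _ _; apply.
Qed.

Definition add_gen I a : set R := [set x | exists c y, I y /\ x = c * a + y].

Lemma is_ideal_add_gen I a : is_ideal I -> is_ideal (add_gen I a).
Proof.
case=> h0 hD hM; split.
- by exists 0, 0; rewrite mul0r addr0.
- move=> _ _ [c [x [hx ->]]] [d [y [hy ->]]]; exists (c + d), (x + y).
  by split; [apply: hD|rewrite mulrDl addrACA].
- move=> b _ [c [x [hx ->]]]; exists (b * c), (b * x).
  by split; [apply: hM|rewrite mulrDr mulrA].
Qed.

Lemma sub_add_gen I a : I `<=` add_gen I a.
Proof. by move=> x hx; exists 0, x; rewrite mul0r add0r. Qed.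

Lemma mem_add_gen I a : is_ideal I -> add_gen I a a.
Proof. by case=> h0 _ _; exists 1, 0; rewrite mul1r addr0. Qed.

Lemma add_gen_min I J a : is_ideal J -> I `<=` J -> J a -> add_gen I a `<=` J.
Proof. by case=> _ hD hM hIJ ha _ [c [y [/hIJ hy ->]]]; apply: hD => //; apply: hM. Qed.

Lemma is_ideal0 : is_ideal [set (0 : R)].
Proof.
split=> //=; first by move=> x y -> ->; rewrite addr0.
by move=> a x ->; rewrite mulr0.
Qed.

(** The ideals generated by prefixes in [regular_sequence] become iterated [add_gen], the form that
    suits induction along the sequence. *)
Lemma ideal_gen_seq s : ideal_gen [set x | x \in s] = foldl add_gen [set 0] s.
Proof.
have fold_ideal t I : is_ideal I -> is_ideal (foldl add_gen I t).
  by elim: t I => //= a t IH I hI; apply/IH/is_ideal_add_gen.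
have fold_sub t I : I `<=` foldl add_gen I t.
  by elim: t I => [|a t IH] I x hx //=; apply: IH; exact: sub_add_gen.
have fold_mem t I x : is_ideal I -> x \in t -> foldl add_gen I t x.
  elim: t I => //= a t IH I hI; rewrite inE => /orP[/eqP ->|xt].
    by apply: fold_sub; apply: mem_add_gen.
  by apply: IH => //; apply: is_ideal_add_gen.
have fold_min t I J : is_ideal J -> I `<=` J -> (forall x, x \in t -> J x) ->
    foldl add_gen I t `<=` J.
  elim: t I => [|a t IH] I hJ hIJ ht //=; apply: IH => //.
    by apply: add_gen_min => //; apply: ht; rewrite mem_head.
  by move=> x xt; apply: ht; rewrite inE xt orbT.
apply/seteqP; split.
  apply: ideal_gen_min; first by apply: fold_ideal; exact: is_ideal0.
  by move=> x xs; apply: fold_mem; first exact: is_ideal0.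
apply: fold_min; [exact: is_ideal_gen| |by move=> x xs; apply: ideal_gen_in].
by move=> _ ->; case: (is_ideal_gen [set x | x \in s]).
Qed.

Section Bundle.
Variables (I : set R) (hI : is_ideal I) (I1 : ~ I 1).

Definition ideal_pred : R -> bool := fun x => `[< I x >].

Lemma ideal_pred_closed : idealr_closed ideal_pred.
Proof.
case: hI => h0 hD hM; split.
- exact/asboolP.
- exact/asboolP.
- move=> a x y; rewrite !unfold_in => /asboolP hx /asboolP hy; apply/asboolP.
  by apply: hD => //; apply: hM.
Qed.
HB.instance Definition _ := isIdealr.Build R ideal_pred ideal_pred_closed.

Definition idealr_of : idealr R := ideal_pred.

Lemma mem_idealr_of x : (x \in (idealr_of : pred R)) = `[< I x >].
Proof. by []. Qed.

Hypothesis prime_I : forall x y, I (x * y) -> I x \/ I y.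

Lemma ideal_pred_prime : prime_idealr_closed ideal_pred.
Proof.
by move=> x y; rewrite !unfold_in => /asboolP /prime_I [] h; apply/orP; [left|right];
  apply/asboolP.
Qed.
HB.instance Definition _ := isPrimeIdealrClosed.Build R ideal_pred ideal_pred_prime.

Definition prime_idealr_of : prime_idealr R := ideal_pred.

Lemma mem_prime_idealr_of x : (x \in (prime_idealr_of : pred R)) = `[< I x >].
Proof. by []. Qed.
End Bundle.

Lemma idealr_is_ideal (J : idealr R) : is_ideal [set x | x \in (J : pred R)].
Proof.
split=> /=; first exact: idealr0.
- by move=> x y hx hy; rewrite rpredD.
- by move=> a x hx; rewrite idealMr.
Qed.

(** An ideal maximal among those that contain [J] and miss the multiplicative set [T] is prime: if
    it contained [x * y] but neither factor, adjoining [x] or [y] would catch elements of [T] whose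
    product lies in the ideal. *)
Lemma exists_prime_avoiding J T :
  is_ideal J -> T 1 -> (forall x y, T x -> T y -> T (x * y)) ->
  (forall x, J x -> ~ T x) ->
  exists Q : prime_idealr R, (forall x, J x -> x \in (Q : pred R)) /\
    forall x, T x -> x \notin (Q : pred R).
Proof.
move=> hJ T1 TM hJT.
pose good A := [/\ is_ideal A, J `<=` A & forall x, A x -> ~ T x].
(* [Zorn_bigcup] also demands the union of the empty chain, hence the alternative [A = set0], which
   is discarded below because [J] is good. *)
have [A [hA maxA]] : exists A, (A = set0 \/ good A) /\
    forall B, A `<` B -> ~ (B = set0 \/ good B).
  apply: Zorn_bigcup => F hF totF.
  have [[B FB [b Bb]]|noB] := pselect (exists2 B, F B & exists b, B b); last first.
    left; apply/seteqP; split=> // x [B FB Bx].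
    by apply: noB; exists B => //; exists x.
  have goodF C c : F C -> C c -> good C.
    by move=> FC Cc; case: (hF _ FC) => [C0|//]; rewrite C0 in Cc.
  right; split; last by move=> x [C FC Cx]; case: (goodF _ _ FC Cx) => _ _; apply.
    have gB := goodF _ _ FB Bb.
    split; first by exists B => //; case: gB => -[].
      move=> x y [C FC Cx] [D FD Dy].
      have gC := goodF _ _ FC Cx; have gD := goodF _ _ FD Dy.
      have [CD|DC] := totF C D FC FD.
        by exists D => //; case: gD => -[_ hD _] _ _; apply: hD => //; apply: CD.
      by exists C => //; case: gC => -[_ hD _] _ _; apply: hD => //; apply: DC.
    by move=> a x [C FC Cx]; exists C => //; case: (goodF _ _ FC Cx) => -[_ _ hM] _ _; apply: hM.
  by move=> x Jx; exists B => //; case: (goodF _ _ FB Bb) => _ + _; apply.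
have goodJ : good J by split=> // x.
have gA : good A.
  case: hA => // A0; case: (maxA J); last by right.
  rewrite A0; split; first by apply: sub0set.
  by move=> h; have := h 0; case: hJ => J0 _ _ /(_ J0).
have [idA JA AT] := gA.
have hit a : ~ A a -> exists t, T t /\ add_gen A a t.
  move=> nAa; apply: contrapT => no.
  apply: (maxA (add_gen A a)).
    split; first exact: sub_add_gen.
    by move=> h; apply/nAa/h/mem_add_gen.
  right; split; first exact: is_ideal_add_gen.
    by move=> x /JA; apply: sub_add_gen.
  by move=> x hx Tx; apply: no; exists x.
have prA x y : A (x * y) -> A x \/ A y.
  move=> Axy; have [Ax|nAx] := pselect (A x); first by left.
  have [Ay|nAy] := pselect (A y); first by right.
  have [t [Tt [c [u [Au tE]]]]] := hit x nAx.
  have [v [Tv [d [w [Aw vE]]]]] := hit y nAy.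
  exfalso; apply: (AT (t * v)); last exact: TM.
  have [_ hD hM] := idA.
  have -> : t * v = (c * d) * (x * y) + (c * x + u) * w + (d * y) * u.
    by rewrite tE vE; ring.
  by apply: (hD _ _ (hD _ _ _ _)); apply: (hM).
have A1 : ~ A 1 by move=> /AT.
exists (prime_idealr_of idA A1 prA); split=> x hx; rewrite mem_prime_idealr_of.
  by apply/asboolP/JA.
by apply/asboolP => /AT.
Qed.

(** Regularity modulo [J] without properness of the final ideal; properness is checked separately
    where a [regular_sequence] is produced. *)
Fixpoint weakly_regular (J : set R) s : Prop :=
  if s is a :: s' then
    (forall b, J (a * b) -> J b) /\ weakly_regular (add_gen J a) s'
  else True.

Lemma weakly_regularP J s :
  weakly_regular J s <->
  forall i, (i < size s)%N -> forall b,
    foldl add_gen J (take i s) (s`_i * b) -> foldl add_gen J (take i s) b.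
Proof.
elim: s J => [|a s IH] J /=; first by split.
split=> [[ha /IH hs] [|i] //= |h]; first exact: hs.
split; first exact: (h 0%N).
by apply/IH => i hi; apply: (h i.+1).
Qed.

(* If a is regular modulo J and lies in the prime P, then no s a^n with s     *)
(* outside P lies in J, so some prime between J and P avoids a.               *)
Lemma weakly_regular_prime_chain J s (P : prime_idealr R) :
  is_ideal J -> (forall x, J x -> x \in (P : pred R)) ->
  {subset s <= (P : pred R)} -> weakly_regular J s ->
  exists p, [/\ prime_chain p (size s), p (size s) = P &
                forall x, J x -> x \in (p 0%N : pred R)].
Proof.
elim: s J => [|a s IH] J idJ JP sP /=; first by exists (fun=> P).
case=> reg_a reg_s.
have aP : a \in (P : pred R) by apply: sP; rewrite mem_head.
have [|||p [chain_p pP Jp]] := IH (add_gen J a) _ _ _ reg_s.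
- exact: is_ideal_add_gen.
- apply: (@add_gen_min J [set x | x \in (P : pred R)]) => //.
  exact: idealr_is_ideal.
- by move=> x xs; apply: sP; rewrite inE xs orbT.
pose p0 := (p 0%N : pred R).
have [|||Q [JQ QT]] := @exists_prime_avoiding J
    [set x | exists u n, u \notin p0 /\ x = u * a ^+ n] idJ.
- by exists 1, 0%N; rewrite mulr1 /p0 idealr1.
- move=> _ _ [u [n [hu ->]]] [v [m [hv ->]]]; exists (u * v), (n + m)%N.
  by rewrite /p0 prime_idealrM negb_or hu hv exprD mulrACA.
- move=> x Jx [u [n [hu xE]]]; move: hu; rewrite /p0 Jp //; apply: sub_add_gen.
  elim: n x xE Jx => [|n IHn] x ->; first by rewrite mulr1.
  by rewrite exprS mulrCA => /reg_a; apply: IHn.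
exists (fun i => if i is j.+1 then p j else Q); split=> //.
case=> [_|i]; last exact: chain_p.
split=> [x /=|h].
  apply: contraTT => xp0; apply: QT; exists x, 0%N; rewrite mulr1; split=> //.
have /h /= : a \in p0 by apply: Jp; apply: mem_add_gen.
by apply/negP/QT; exists 1, 1%N; rewrite mul1r expr1 /p0 idealr1.
Qed.

Lemma regular_sequence_prime_chain J s (P : prime_idealr R) :
  is_ideal J -> (forall x, J x -> x \in (P : pred R)) ->
  {subset s <= (P : pred R)} -> weakly_regular J s ->
  exists p : nat -> prime_idealr R, prime_chain p (size s).
Proof. by move=> h1 h2 h3 /(weakly_regular_prime_chain h1 h2 h3) [p []]; exists p. Qed.

End Ideals.

(** * Noetherian rings *)

Definition ideals_fg (R : comNzRingType) : Prop :=
  forall I : set R, is_ideal I -> exists s : seq R, I = ideal_gen [set x | x \in s].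

Lemma ideals_fg_noetherian (R : comNzRingType) : ideals_fg R -> noetherian R.
Proof. by move=> h I; apply: h; apply: idealr_is_ideal. Qed.

Lemma ideal_gen_sub (R : comNzRingType) (A B : set R) :
  A `<=` B -> ideal_gen A `<=` ideal_gen B.
Proof.
move=> AB; apply: ideal_gen_min; first exact: is_ideal_gen.
by move=> x /AB; apply: ideal_gen_in.
Qed.

Section Transfer.
Variables (S T : comNzRingType) (phi : {rmorphism S -> T}).
Hypothesis frac : forall z, exists p q v, v * phi q = 1 /\ z * phi q = phi p.

(** Each element of an ideal of [T] is a unit times the image of an element of its preimage, so
    generators of the preimage suffice. Quotients and localizations are both instances. *)
Lemma ideals_fg_frac : ideals_fg S -> ideals_fg T.
Proof.
move=> fgS I [I0 ID IM].
have [|s sE] := fgS [set x | I (phi x)].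
  split=> /=; first by rewrite rmorph0.
    by move=> x y hx hy; rewrite rmorphD; apply: ID.
  by move=> a x hx; rewrite rmorphM; apply: IM.
exists [seq phi x | x <- s]; apply/seteqP; split; last first.
  apply: ideal_gen_min => // _ /mapP[x xs ->].
  have : ideal_gen [set x | x \in s] x by apply: ideal_gen_in.
  by rewrite -sE.
move=> z Iz; have [p [q [v [vq zq]]]] := frac z.
have : [set x | I (phi x)] p by rewrite /= -zq mulrC; apply: IM.
rewrite sE => -[t [ht pE]].
have -> : z = v * phi p by rewrite -zq mulrCA vq mulr1.
have [_ _ hM] := is_ideal_gen [set x | x \in [seq phi x | x <- s]].
apply: hM; rewrite pE rmorph_sum; apply: is_ideal_sum; first exact: is_ideal_gen.
move=> r /ht rs; rewrite rmorphM; have [_ _ hM] := is_ideal_gen [set x | x \in [seq phi x |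
  x <- s]].
by apply: hM; apply: ideal_gen_in; apply: map_f.
Qed.
End Transfer.

(** * Hilbert's basis theorem *)

Section HilbertBasis.
Variable R : comNzRingType.
Hypothesis fgR : ideals_fg R.

(** A division step: the multiples of the [g a] by ['X^(d - D)] have degree at most [d], and a
    combination of them has the same coefficient as [p] in degree [d]. *)
Lemma cancel_top_coef (s : seq R) (g : R -> {poly R}) (D d : nat) (p : {poly R}) :
  (D <= d)%N -> (forall a, a \in s -> (size (g a) <= D.+1)%N /\ (g a)`_D = a) ->
  (size p <= d.+1)%N -> ideal_gen [set a | a \in s] p`_d ->
  exists q, ideal_gen [set h | h \in map g s] q /\ (size (p - q)%R <= d)%N.
Proof.
move=> Dd hg sp [t [ht pE]].
pose q := \sum_(r <- t) (r.1 *: 'X^(d - D)) * g r.2; exists q; split.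
  apply: is_ideal_sum; first exact: is_ideal_gen.
  move=> r /ht rs; have [_ _ hM] := is_ideal_gen [set h | h \in map g s].
  by apply: hM; apply: ideal_gen_in; apply: map_f.
apply/leq_sizeP => j; rewrite leq_eqVlt => /predU1P[<-|dj].
  rewrite coefB pE /q coef_sum -sumrB big_seq big1 // => r /ht /hg[_ gD].
  by rewrite -scalerAl coefZ coefXnM ltnNge leq_subr subKn //= gD subrr.
rewrite coefB (leq_sizeP _ _ sp) // /q coef_sum big_seq big1 ?subr0 // => r /ht /hg[gs _].
rewrite -scalerAl coefZ coefXnM; case: ifP => _; rewrite ?mulr0 //.
by rewrite (leq_sizeP _ _ gs) ?mulr0 //; lia.
Qed.

Variable I : set {poly R}.
Hypothesis idI : is_ideal I.

Let top_coefs d : set R := [set a | exists p, [/\ I p, (size p <= d.+1)%N & p`_d = a]].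

Lemma is_ideal_top_coefs d : is_ideal (top_coefs d).
Proof.
case: idI => I0 ID IM; split.
- by exists 0; rewrite size_poly0 coef0.
- move=> _ _ [p [Ip sp <-]] [q [Iq sq <-]]; exists (p + q); rewrite coefD; split=> //.
    exact: ID.
  by rewrite (leq_trans (size_polyD _ _)) // geq_max sp.
- move=> a _ [p [Ip sp <-]]; exists (a%:P * p); rewrite coefCM; split=> //.
    exact: IM.
  by rewrite mul_polyC (leq_trans (size_scale_leq _ _)).
Qed.

Lemma top_coefs_mono d e : (d <= e)%N -> top_coefs d `<=` top_coefs e.
Proof.
move=> de a [p [Ip sp pa]]; exists ('X^(e - d) * p); split.
- by case: idI => _ _; apply.
- apply/leq_sizeP => j ej; rewrite coefXnM; case: ifP => // _.
  by rewrite (leq_sizeP _ _ sp) //; lia.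
- by rewrite coefXnM ltnNge leq_subr subKn.
Qed.

Lemma top_coefs_lift d (s : seq R) : (forall a, a \in s -> top_coefs d a) ->
  exists g : R -> {poly R}, forall a, a \in s ->
    [/\ I (g a), (size (g a) <= d.+1)%N & (g a)`_d = a].
Proof.
move=> hs.
have h a : exists p, a \in s -> [/\ I p, (size p <= d.+1)%N & p`_d = a].
  by have [/hs [p hp]|_] := boolP (a \in s); [exists p|exists 0].
by have [g gP] := choice h; exists g.
Qed.

(** Induction on the degree bound: each degree adds lifts of finitely many generators of its ideal
    of top coefficients. *)
Lemma bounded_degree_fg d : exists s : seq {poly R},
  (forall p, p \in s -> I p) /\
  forall p, I p -> (size p <= d)%N -> ideal_gen [set h | h \in s] p.
Proof.
elim: d => [|d [s [sI hs]]].
  exists [::]; split=> // p _; rewrite leqn0 size_poly_eq0 => /eqP ->.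
  by case: (is_ideal_gen [set h : {poly R} | h \in [::]]).
have [t tE] := fgR (is_ideal_top_coefs d).
have [|g gP] := @top_coefs_lift d t.
  by move=> a at_; rewrite tE; apply: ideal_gen_in.
exists (s ++ map g t); split=> [p|p Ip sp].
  by rewrite mem_cat => /orP[/sI //|/mapP[a /gP [Ig _ _] ->]].
have [||||q [qt pq]] := @cancel_top_coef t g d d p => //.
- by move=> a /gP[].
- by rewrite -tE; exists p.
rewrite -(subrK q p).
have [_ hD _] := is_ideal_gen [set h | h \in s ++ map g t].
apply: hD; last first.
  by apply: ideal_gen_sub qt => h /= hh; rewrite mem_cat hh orbT.
have Iq : I q by apply: ideal_gen_min qt => // _ /mapP[a /gP[Ig _ _] ->].
apply: (@ideal_gen_sub _ [set h | h \in s]); last by apply: hs => //; apply: is_idealB.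
by move=> h /= hh; rewrite mem_cat hh.
Qed.

(** The union [L] of the increasing ideals of top coefficients is finitely generated, and its
    generators all occur in one degree [D]. Their lifts reduce any member of degree at least [D];
    below [D], [bounded_degree_fg] takes over. *)
Lemma poly_ideal_fg : exists s : seq {poly R}, I = ideal_gen [set x | x \in s].
Proof.
pose L : set R := [set a | exists d, top_coefs d a].
have idL : is_ideal L.
  split; first by exists 0%N; case: (is_ideal_top_coefs 0).
    move=> x y [d hx] [e hy]; exists (maxn d e).
    have [_ hD _] := is_ideal_top_coefs (maxn d e).
    apply: hD; [apply: top_coefs_mono hx|apply: top_coefs_mono hy].
      exact: leq_maxl.
    exact: leq_maxr.
  move=> a x [d hx]; exists d.
  by have [_ _ hM] := is_ideal_top_coefs d; apply: hM.
have [t tE] := fgR idL.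
have [D hD] : exists D, forall a, a \in t -> top_coefs D a.
  have : forall a, a \in t -> L a by move=> a at_; rewrite tE; apply: ideal_gen_in.
  elim: t {tE} => [|a t IH] ht; first by exists 0%N.
  have [|D hD] := IH; first by move=> b bt; apply: ht; rewrite inE bt orbT.
  have [e he] : L a by apply: ht; rewrite mem_head.
  exists (maxn D e) => b; rewrite inE => /predU1P[->|/hD].
    by apply: top_coefs_mono he; apply: leq_maxr.
  by apply: top_coefs_mono; apply: leq_maxl.
have [g gP] := top_coefs_lift hD.
have [s [sI hs]] := bounded_degree_fg D.
exists (s ++ map g t); apply/seteqP; split; last first.
  apply: ideal_gen_min => // p; rewrite /= mem_cat => /orP[/sI //|].
  by move=> /mapP[a /gP[Ig _ _] ->].
have idG := is_ideal_gen [set h | h \in s ++ map g t].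
have main d : forall p, I p -> (size p <= d)%N -> ideal_gen [set h | h \in s ++ map g t] p.
  elim: d => [|d IH] p Ip sp.
    by move: sp; rewrite leqn0 size_poly_eq0 => /eqP ->; case: idG.
  have [dD|Dd] := ltnP d D.
    apply: (@ideal_gen_sub _ [set h | h \in s]); last by apply: hs => //; apply: leq_trans dD.
    by move=> h /= hh; rewrite mem_cat hh.
  have [|||q [qt pq]] := @cancel_top_coef t g D d p Dd => //.
  - by move=> a /gP[].
  - by rewrite -tE; exists d, p.
  rewrite -(subrK q p); have [_ GD _] := idG; apply: GD; last first.
    by apply: ideal_gen_sub qt => h /= hh; rewrite mem_cat hh orbT.
  have Iq : I q by apply: ideal_gen_min qt => // _ /mapP[a /gP[Ig _ _] ->].
  by apply: IH => //; apply: is_idealB.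
by move=> p Ip; apply: (main (size p)).
Qed.

End HilbertBasis.

Lemma ideals_fg_poly (R : comNzRingType) : ideals_fg R -> ideals_fg {poly R}.
Proof. by move=> fgR I; apply: poly_ideal_fg. Qed.

Lemma ideals_fg_field (k : fieldType) : ideals_fg k.
Proof.
move=> I hI; have [I0 _ _] := hI; have [[a [Ia a0]]|no] := pselect (exists a, I a /\ a != 0).
  exists [:: a]; apply/seteqP; split.
    move=> x Ix; exists [:: (x / a, a)]; split; last by rewrite big_seq1 divfK.
    by move=> p; rewrite inE => /eqP -> /=; rewrite inE.
  by apply: ideal_gen_min => // x; rewrite /= inE => /eqP ->.
exists [::]; apply/seteqP; split.
  move=> x Ix; have -> : x = 0.
    by apply/eqP/negP => x0; apply: no; exists x; split=> //; apply/negP.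
  by exists [::]; rewrite big_nil.
by apply: ideal_gen_min.
Qed.

Lemma ideals_fg_surj (S T : comNzRingType) (phi : {rmorphism S -> T}) :
  (forall z, exists p, phi p = z) -> ideals_fg S -> ideals_fg T.
Proof.
move=> surj; apply: (ideals_fg_frac (phi := phi)) => z; have [p pz] := surj z.
by exists p, 1, 1; rewrite rmorph1 !mulr1 pz.
Qed.

(* Every element of k[x_0..x_n] is a polynomial in x_n over k[x_0..x_(n-1)].  *)
Lemma ideals_fg_mpoly (k : fieldType) n : ideals_fg {mpoly k[n]}.
Proof.
elim: n => [|n IH].
  apply: (@ideals_fg_surj k _ (mpolyC 0 (R := k))); last exact: ideals_fg_field.
  by move=> z; exists z@_0%MM; rewrite [RHS]nvar0_mpolyC.
have fgP := ideals_fg_poly IH.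
pose ev := mmap (@mpolyC n.+1 k) (fun i : 'I_n => 'X_(widen_ord (leqnSn n) i)).
have evX j : ev 'X_j = 'X_(widen_ord (leqnSn n) j) by rewrite /ev mmapX mmap1U.
have evC c : ev c%:MP = c%:MP by rewrite /ev mmapC.
have cev : commr_rmorph ev ('X_ord_max : {mpoly k[n.+1]}) by move=> x; apply: mulrC.
have hC q : horner_morph cev q%:P = ev q by exact: horner_morphC.
apply: (@ideals_fg_surj _ _ (horner_morph cev)) fgP => z.
elim/mpolyind: z => [|c m p _ _ [q <-]]; first by exists 0; rewrite rmorph0.
suff [r rE] : exists r, horner_morph cev r = c *: 'X_[m].
  by exists (r + q); rewrite rmorphD /= rE.
rewrite -mul_mpolyC [X in _%:MP * X]mpolyXE_id.
have [u uE] : exists r, horner_morph cev r = \prod_(i < n.+1) 'X_i ^+ m i.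
  apply: (big_ind (fun y => exists r, horner_morph cev r = y)).
  - by exists 1; rewrite rmorph1.
  - by move=> _ _ [r <-] [s <-]; exists (r * s); rewrite rmorphM.
  move=> i _; have [j ->|->] := unliftP ord_max i.
    exists ((('X_j : {mpoly k[n]})%:P) ^+ m (lift ord_max j)); rewrite rmorphXn /= hC.
    rewrite evX; congr ('X_ _ ^+ _); apply/val_inj => /=.
    by rewrite /bump leqNgt ltn_ord.
  by exists ('X ^+ m ord_max); rewrite rmorphXn /= horner_morphX.
by exists ((c%:MP)%:P * u); rewrite rmorphM /= uE hC evC.
Qed.

(** * Localizations *)

Section Localizes.
Variables (S T : comNzRingType) (phi : {rmorphism S -> T}) (I N : set S).

(* T is the localization of S / I at its prime ideal N / I.                   *)
Record localizes : Prop := Localizes {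
  loc_ideal : is_ideal I;
  loc_prime_ideal : is_ideal N;
  loc_proper : ~ N 1;
  loc_prime : forall x y, N (x * y) -> N x \/ N y;
  loc_sub : I `<=` N;
  loc_unit : forall q, ~ N q -> exists v, v * phi q = 1;
  loc_frac : forall z, exists p q, ~ N q /\ z * phi q = phi p;
  loc_zero : forall p, phi p = 0 <-> exists u, ~ N u /\ I (u * p) }.

Hypothesis loc : localizes.

(** The extension of [J] to [T], described by fractions [p / q] with numerator in [J]. *)
Definition extended (J : set S) : set T :=
  [set z | exists p q, [/\ ~ N q, z * phi q = phi p & J p]].

Lemma loc_notinM u v : ~ N u -> ~ N v -> ~ N (u * v).
Proof. by move=> hu hv /(loc_prime loc) []. Qed.

(** Contracting the extension of [J] gives its saturation by the complement of [N]; this reduces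
    membership questions in [T] to [S]. *)
Lemma mem_extended J p : is_ideal J -> I `<=` J ->
  extended J (phi p) <-> exists u, ~ N u /\ J (u * p).
Proof.
move=> [J0 JD JM] IJ; split=> [[r [q [Nq + Jr]]]|[u [Nu Ju]]]; last first.
  by exists (u * p), u; split=> //; rewrite rmorphM mulrC.
rewrite -rmorphM => e.
have /(loc_zero loc)[u [Nu Iu]] : phi (p * q - r) = 0 by rewrite rmorphB e subrr.
exists (u * q); split; first exact: loc_notinM.
have -> : u * q * p = u * (p * q - r) + u * r by ring.
by apply: (JD); [apply: IJ|apply: JM].
Qed.

Lemma extendedE J z p q : is_ideal J -> I `<=` J -> ~ N q -> z * phi q = phi p ->
  extended J z <-> extended J (phi p).
Proof.
move=> idJ IJ Nq zq; rewrite -zq; split=> -[r [s [Ns e Jr]]].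
  exists (q * r), s; split=> //; last by case: idJ => _ _; apply.
  by rewrite rmorphM -e; ring.
exists r, (q * s); split=> //; first exact: loc_notinM.
by rewrite rmorphM mulrA.
Qed.

Lemma extended0 : extended I = [set 0].
Proof.
apply/seteqP; split=> z /=.
  move=> [p [q [Nq e Ip]]]; have [v vq] := loc_unit loc Nq.
  have p0 : phi p = 0.
    by apply/(loc_zero loc); exists 1; rewrite mul1r; split=> //; case: loc.
  by rewrite -[z]mulr1 -vq mulrCA e p0 mulr0.
move=> ->; exists 0, 1; rewrite rmorph0 mul0r; split=> //; first by case: loc.
by case: (loc_ideal loc).
Qed.

Lemma is_ideal_extended J : is_ideal J -> is_ideal (extended J).
Proof.
move=> [J0 JD JM]; split.
- by exists 0, 1; rewrite rmorph0 mul0r; split=> //; case: loc.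
- move=> x y [p [q [Nq e Jp]]] [r [s [Ns f Jr]]].
  exists (s * p + q * r), (q * s); split; first exact: loc_notinM.
    by rewrite rmorphD !rmorphM -e -f; ring.
  by apply: (JD); apply: JM.
move=> a x [p [q [Nq e Jp]]]; have [r [s [Ns f]]] := loc_frac loc a.
exists (r * p), (s * q); split; first exact: loc_notinM.
  by rewrite !rmorphM -e -f; ring.
exact: JM.
Qed.

Lemma extended_add_gen J a : is_ideal J -> I `<=` J ->
  extended (add_gen J a) = add_gen (extended J) (phi a).
Proof.
move=> idJ IJ; have idJ' := is_ideal_add_gen a idJ.
have idE := is_ideal_extended idJ.
apply/seteqP; split=> z; last first.
  move=> [c [y [[p [q [Nq e Jp]]] ->]]]; have [r [s [Ns f]]] := loc_frac loc c.
  exists (r * q * a + s * p), (s * q); split; first exact: loc_notinM.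
    by rewrite !(rmorphD, rmorphM) -e -f; ring.
  exists (r * q), (s * p); split=> //; by case: idJ => _ _; apply.
move=> [p [q [Nq e [c [y [Jy pE]]]]]].
have [v vq] := loc_unit loc Nq.
exists (v * phi c), (v * phi y); split; last first.
  by rewrite -[z]mulr1 -vq mulrCA e pE rmorphD rmorphM; ring.
have [_ _ EM] := idE; apply: (EM); exists y, 1; rewrite rmorph1 mulr1; split=> //.
by case: loc.
Qed.

(** Localization preserves regularity: after clearing denominators, a multiple of [a * p] by some
    [u] outside [N] lies in [J], and [a] can be cancelled there. *)
Lemma weakly_regular_extended J (s : seq S) : is_ideal J -> I `<=` J ->
  weakly_regular J s -> weakly_regular (extended J) (map phi s).
Proof.
elim: s J => [|a s IH] J idJ IJ //= [reg_a reg_s]; split; last first.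
  rewrite -extended_add_gen //; apply: IH => //; first exact: is_ideal_add_gen.
  by move=> x /IJ; apply: sub_add_gen.
move=> b; have [p [q [Nq e]]] := loc_frac loc b.
have e2 : phi a * b * phi q = phi (a * p) by rewrite -mulrA e rmorphM.
rewrite (extendedE idJ IJ Nq e) (extendedE idJ IJ Nq e2).
rewrite !mem_extended // => -[u [Nu]]; rewrite mulrCA => /reg_a h.
by exists u.
Qed.

Lemma extended_prime_mem p : extended N (phi p) <-> N p.
Proof.
rewrite mem_extended; [|exact: loc_prime_ideal|exact: loc_sub].
split=> [[u [Nu /(loc_prime loc) [] //]]|Np]; exists 1; rewrite mul1r; split=> //.
exact: loc_proper.
Qed.

Lemma extended_prime_proper : ~ extended N 1.
Proof. by rewrite -(rmorph1 phi) extended_prime_mem; apply: loc_proper. Qed.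

Lemma extended_prime_nonunit z : extended N z <-> ~ exists v, v * z = 1.
Proof.
split=> [Nz [v vz]|].
  apply: extended_prime_proper; rewrite -vz.
  by have [_ _] := is_ideal_extended (loc_prime_ideal loc); apply.
have [p [q [Nq e]]] := loc_frac loc z => h.
exists p, q; split=> //; apply: contrapT => /(loc_unit loc)[v vp]; apply: h.
by exists (v * phi q); rewrite -mulrA [_ * z]mulrC e.
Qed.

Lemma extended_prime_prime x y : extended N (x * y) -> extended N x \/ extended N y.
Proof.
rewrite !extended_prime_nonunit => h; apply: contrapT => /not_orP[].
move=> /contrapT[v vx] /contrapT[w wy]; apply: h.
by exists (v * w); rewrite mulrACA vx wy mulr1.
Qed.

Definition loc_max : prime_idealr T :=
  prime_idealr_of (is_ideal_extended (loc_prime_ideal loc)) extended_prime_proper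
    extended_prime_prime.

Lemma mem_loc_max z : z \in (loc_max : pred T) <-> extended N z.
Proof. by rewrite mem_prime_idealr_of; split=> /asboolP. Qed.

(** A proper ideal contains no unit, and [loc_max] consists of all the non-units. *)
Lemma sub_loc_max (J : idealr T) : {subset (J : pred T) <= (loc_max : pred T)}.
Proof.
move=> z zJ; apply/mem_loc_max/extended_prime_nonunit => -[v vz].
by have := idealr1 J; rewrite -vz idealMr.
Qed.

Lemma local_ring_loc_max : local_ring (loc_max : idealr T).
Proof.
split=> [J _|M' maxM' z]; first exact: sub_loc_max.
by apply/idP/idP; [apply: sub_loc_max|apply: maxM'; apply: sub_loc_max].
Qed.

End Localizes.

Section QuotientMap.
Variables (S : comNzRingType) (J : idealr S).

Definition quot_map (x : S) : {ideal_quot J} := \pi_{ideal_quot J} x.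

Lemma quot_map_is_zmod_morphism : zmod_morphism quot_map.
Proof. by move=> x y; rewrite /quot_map !piE. Qed.
HB.instance Definition _ := GRing.isZmodMorphism.Build S {ideal_quot J} quot_map
  quot_map_is_zmod_morphism.

Lemma quot_map_is_monoid_morphism : monoid_morphism quot_map.
Proof. by split=> [|x y]; rewrite /quot_map !piE. Qed.
HB.instance Definition _ := GRing.isMonoidMorphism.Build S {ideal_quot J} quot_map
  quot_map_is_monoid_morphism.

Lemma quot_map_eq0 x : quot_map x = 0 <-> x \in (J : pred S).
Proof.
rewrite -(rmorph0 quot_map) -[x in X in _ <-> X]subr0 Quotient.idealrBE.
by split=> [h|/eqP]; [apply/eqP|].
Qed.

End QuotientMap.

Section QuotientLocalization.
Variables (S : comNzRingType) (J : idealr S) (M : prime_idealr {ideal_quot J}).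

Definition to_loc (x : S) : localization M :=
  \pi_(localization M) (quot_map J x, Localization.den1 M).

Lemma to_loc_is_zmod_morphism : zmod_morphism to_loc.
Proof.
move=> x y; transitivity (Localization.add (to_loc x) (Localization.opp (to_loc y))); last by [].
rewrite /to_loc rmorphB -Localization.pi_opp -Localization.pi_add.
apply/eqmodP/Localization.equivP; exists (Localization.den1 M) => /=.
by rewrite !mulr1 !mul1r.
Qed.
HB.instance Definition _ := GRing.isZmodMorphism.Build S (localization M) to_loc
  to_loc_is_zmod_morphism.

Lemma to_loc_is_monoid_morphism : monoid_morphism to_loc.
Proof.
split=> [|x y].
  transitivity (Localization.one M); last by [].
  by rewrite /to_loc rmorph1 /Localization.one; unlock.
transitivity (Localization.mul (to_loc x) (to_loc y)); last by [].
rewrite /to_loc rmorphM -Localization.pi_mul.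
apply/eqmodP/Localization.equivP; exists (Localization.den1 M) => /=.
by rewrite !mulr1 !mul1r.
Qed.
HB.instance Definition _ := GRing.isMonoidMorphism.Build S (localization M) to_loc
  to_loc_is_monoid_morphism.

Definition contracted : set S := [set x | quot_map J x \in (M : pred _)].

(** The bridge to the concrete construction: the arguments about local rings of [S / J] use only the
    properties collected in [localizes], and so take place in [S]. *)
Lemma localizes_to_loc : localizes to_loc [set x | x \in (J : pred S)] contracted.
Proof.
have zeroE : (0 : localization M) = \pi_(localization M) (0, Localization.den1 M).
  by transitivity (Localization.zero M) => //; rewrite /Localization.zero; unlock.
split; rewrite /contracted /=.
- exact: idealr_is_ideal.
- split=> /=; first by rewrite rmorph0 idealr0.
    by move=> x y hx hy; rewrite rmorphD rpredD.
  by move=> a x hx; rewrite rmorphM idealMr.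
- by rewrite rmorph1 idealr1.
- by move=> x y; rewrite rmorphM prime_idealrM => /orP.
- by move=> x /= /quot_map_eq0 ->; apply: idealr0.
- move=> q /negP Nq; pose z := \pi_(localization M) (1, exist _ (quot_map J q) Nq).
  exists z; transitivity (Localization.mul z (to_loc q)) => //.
  transitivity (Localization.one M) => //.
  rewrite -Localization.pi_mul /Localization.one; unlock.
  by apply/eqmodP/Localization.equivP; exists (Localization.den1 M) => /=; rewrite !mulr1 !mul1r.
- elim/quotW => -[r [s Ns]].
  exists (repr r), (repr s); rewrite /quot_map reprK; split; first exact/negP.
  transitivity (Localization.mul (\pi_(localization M) (r, exist _ s Ns)) (to_loc (repr
    s))) => //.
  rewrite -Localization.pi_mul /to_loc /quot_map !reprK.
  by apply/eqmodP/Localization.equivP; exists (Localization.den1 M) => /=; rewrite !mulr1 !mul1r.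
- move=> p; rewrite zeroE /to_loc; split.
    move=> /eqmodP/Localization.equivP[[u Nu]] /=; rewrite !mulr1 mulr0 => up.
    exists (repr u); rewrite /quot_map reprK; split; first exact/negP.
    by apply/quot_map_eq0; rewrite rmorphM /= [quot_map J (repr u)]reprK.
  move=> [u [/negP Nu /= up]]; apply/eqmodP/Localization.equivP.
  exists (exist _ (quot_map J u) Nu) => /=; rewrite !mulr1 mulr0 -rmorphM.
  exact/quot_map_eq0.
Qed.

End QuotientLocalization.

Lemma ideals_fg_localizes (S T : comNzRingType) (phi : {rmorphism S -> T}) I N :
  localizes phi I N -> ideals_fg S -> ideals_fg T.
Proof.
move=> loc; apply: (ideals_fg_frac (phi := phi)) => z.
have [p [q [Nq e]]] := loc_frac loc z; have [v vq] := loc_unit loc Nq.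
by exists p, q, v.
Qed.

Lemma ideals_fg_quot (S : comNzRingType) (J : idealr S) :
  ideals_fg S -> ideals_fg {ideal_quot J}.
Proof.
apply: (ideals_fg_surj (phi := quot_map J)) => z.
by exists (repr z); rewrite /= /quot_map reprK.
Qed.

Lemma regular_sequence_weakly (R : comNzRingType) (s : seq R) :
  regular_sequence s -> weakly_regular [set 0] s.
Proof.
by move=> [h _]; apply/weakly_regularP => i hi b; rewrite -!ideal_gen_seq; apply: h.
Qed.

Lemma regular_sequence_in_chain (R : comNzRingType) (M : prime_idealr R) (s : seq R) :
  regular_sequence_in (M : idealr R) s ->
  exists p : nat -> prime_idealr R, prime_chain p (size s).
Proof.
move=> [/regular_sequence_weakly hs sM].
apply: (@regular_sequence_prime_chain _ [set 0] s M) => //; first exact: is_ideal0.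
by move=> _ ->; apply: idealr0.
Qed.

(** A regular sequence of length r in the maximal ideal yields a chain of r + 1 primes. A regular
    sequence as long as the dimension bound therefore forces depth and dimension to equal its
    length. *)
Lemma localizes_cohen_macaulay (S T : comNzRingType) (phi : {rmorphism S -> T}) I N
    (s : seq S) :
  localizes phi I N -> ideals_fg S -> weakly_regular I s -> (forall x, x \in s -> N x) ->
  (forall (p : nat -> prime_idealr T) d, prime_chain p d -> (d <= size s)%N) ->
  cohen_macaulay_local T.
Proof.
move=> loc fgS reg_s sN dimT; split.
  exact/ideals_fg_noetherian/(ideals_fg_localizes loc).
exists (loc_max loc : idealr T); split; first exact: local_ring_loc_max.
have reg : regular_sequence_in (loc_max loc : idealr T) (map phi s).
  split; last first.
    move=> _ /mapP[x /sN Nx ->]; by apply/mem_loc_max/(extended_prime_mem loc).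
  split.
    have : weakly_regular [set 0] (map phi s).
      rewrite -(extended0 loc).
      by apply: (weakly_regular_extended loc) => //; apply: (loc_ideal loc).
    by move=> h i hi b; rewrite !ideal_gen_seq; apply: (iffLR (weakly_regularP _ _) h).
  move=> /(ideal_gen_min (idealr_is_ideal (loc_max loc : idealr T))) h.
  have /= := idealr1 (loc_max loc : idealr T); rewrite h // => _ /mapP[x /sN Nx ->].
  exact/mem_loc_max/(extended_prime_mem loc).
exists (size s); split; last first.
  split; last exact: dimT.
  by have := regular_sequence_in_chain reg; rewrite size_map.
split; first by exists (map phi s); rewrite size_map.
by move=> t /regular_sequence_in_chain [p]; apply: dimT.
Qed.

(** * Dimension at most two *)

Lemma linear_dependence (k : fieldType) (X Y : finType) (F : X -> Y -> k) :
  (#|Y| < #|X|)%N ->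
  exists c : X -> k, (exists x, c x != 0) /\ forall y, \sum_x c x * F x y = 0.
Proof.
move=> YX; pose A := \matrix_(i < #|X|, j < #|Y|) F (enum_val i) (enum_val j).
have : kermx A != 0.
  rewrite kermx_eq0 /row_free neq_ltn (leq_ltn_trans (rank_leq_col A)) //.
case/rowV0Pn => v /sub_kermxP vA v0.
exists (fun x => v ord0 (enum_rank x)); split.
  have [i vi] : exists i, v ord0 i != 0.
    apply: contrapT => no; move/eqP: v0; apply; apply/rowP => i; rewrite mxE.
    by apply: contrapT => /eqP vi; apply: no; exists i.
  by exists (enum_val i); rewrite enum_valK.
move=> y; have /rowP/(_ (enum_rank y)) := vA; rewrite !mxE => e; rewrite -[RHS]e.
rewrite (reindex (@enum_val X X)) /=; last first.
  by exists (fun x => enum_rank x) => x _; [rewrite enum_valK|rewrite enum_rankK].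
by apply: eq_bigr => i _; rewrite !mxE enum_valK enum_rankK.
Qed.

Section AlgebraicDependence.
Variable k : fieldType.
Local Notation K2 := {poly {poly k}}.

Definition bidegree_le (d : nat) (b : K2) : Prop :=
  (size b <= d.+1)%N /\ forall i, (size (b`_i)%R <= d.+1)%N.

Lemma bidegree_leM d e b c :
  bidegree_le d b -> bidegree_le e c -> bidegree_le (d + e) (b * c).
Proof.
move=> [sb hb] [sc hc]; split.
  by apply: leq_trans (size_polyMleq _ _) _; move: sb sc; lia.
move=> i; rewrite coefM (leq_trans (size_sum _ _ _)) //.
apply/bigmax_leqP => j _; apply: leq_trans (size_polyMleq _ _) _.
by have := hb j; have := hc (i - j)%N; lia.
Qed.

Lemma bidegree_leX d b n : bidegree_le d b -> bidegree_le (n * d) (b ^+ n).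
Proof.
move=> hb; elim: n => [|n IH]; last by rewrite exprS mulSn; apply: bidegree_leM.
rewrite expr0 mul0n; split; first by rewrite size_poly1.
by move=> i; rewrite coef1; case: (i == 0%N); rewrite ?size_poly1 ?size_poly0.
Qed.

Lemma bidegree_le_trans d e b : (d <= e)%N -> bidegree_le d b -> bidegree_le e b.
Proof. by move=> de [sb hb]; split=> [|i]; [move: sb|move: (hb i)]; lia. Qed.

Lemma exists_bidegree b : exists d, bidegree_le d b.
Proof.
exists (size b + \max_(i < size b) size (b`_i)%R)%N; split; first by lia.
move=> i; have [ib|bi] := ltnP i (size b); last by rewrite nth_default // size_poly0.
by have := @leq_bigmax _ (fun i : 'I_(size b) => size (b`_i)%R) (Ordinal ib); rewrite /=; lia.
Qed.

(** Counting: the [N ^ 3] products have degree at most [N * D] in each variable, so they lie in a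
    space of dimension [(N * D + 1) ^ 2], at most [N ^ 2 * (D + 1) ^ 2]. Taking
    [N = (D + 1) ^ 2 + 1] makes this less than [N ^ 3]. *)
Lemma algebraic_dependence (b0 b1 b2 : K2) : exists N,
  exists c : 'I_N * 'I_N * 'I_N -> k, (exists x, c x != 0) /\
    \sum_x (c x)%:P%:P * (b0 ^+ x.1.1 * b1 ^+ x.1.2 * b2 ^+ x.2) = 0.
Proof.
have [d0 h0] := exists_bidegree b0; have [d1 h1] := exists_bidegree b1.
have [d2 h2] := exists_bidegree b2.
pose D := (d0 + d1 + d2)%N; pose N := ((D.+1) ^ 2).+1; pose L := (N * D).+1.
pose F (x : 'I_N * 'I_N * 'I_N) := b0 ^+ x.1.1 * b1 ^+ x.1.2 * b2 ^+ x.2.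
have hF x : bidegree_le (N * D) (F x).
  apply: (@bidegree_le_trans (x.1.1 * d0 + x.1.2 * d1 + x.2 * d2)%N).
    rewrite /D !mulnDr; case: x => -[i j] l /=.
    by apply: leq_add; [apply: leq_add|]; rewrite leq_mul2r ltnW ?orbT.
  by do 2?apply: bidegree_leM; apply: bidegree_leX.
have [|c [c0 hc]] := @linear_dependence k _ _
    (fun x (y : 'I_L * 'I_L) => (F x)`_y.1`_y.2).
  rewrite !card_prod !card_ord.
  have : (L <= N * D.+1)%N by rewrite /L mulnS; rewrite /N; lia.
  move=> h; apply: (@leq_ltn_trans ((N * D.+1) * (N * D.+1))); first exact: leq_mul.
  rewrite mulnACA ltn_pmul2l; last by rewrite muln_gt0.
  by rewrite /N -mulnn.
exists N, c; split=> //; apply/polyP => u; apply/polyP => v; rewrite !coef0.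
have [uL|Lu] := ltnP u L; last first.
  rewrite coef_sum coef_sum big1 // => x _; rewrite !coefCM.
  by have [+ _] := hF x => /leq_sizeP ->; rewrite ?coef0 ?mulr0.
have [vL|Lv] := ltnP v L; last first.
  rewrite coef_sum coef_sum big1 // => x _; rewrite !coefCM.
  by have [_ /(_ u)] := hF x => /leq_sizeP ->; rewrite ?mulr0.
rewrite -[RHS](hc (Ordinal uL, Ordinal vL)) !coef_sum; apply: eq_bigr => x _.
by rewrite !coefCM.
Qed.
End AlgebraicDependence.

Section TrailingCoefficient.
Variables (B T : comNzRingType) (ev : {rmorphism B -> T}) (p p' : prime_idealr T).

(** Powers of ['X] dividing [Q] cancel because [a] is outside the prime [p]. Once the constant
    coefficient is non-zero, its image lies in [p'], since [a] and the value of [Q] do. *)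
Lemma trailing_coefficient (a : T) (Q : {poly B}) :
  Q != 0 -> {subset (p : pred T) <= (p' : pred T)} -> a \notin (p : pred T) ->
  a \in (p' : pred T) -> (map_poly ev Q).[a] \in (p : pred T) ->
  exists b, b != 0 /\ ev b \in (p' : pred T).
Proof.
move=> Q0 pp' ap ap'; elim/poly_ind: Q Q0 => [|Q c IH]; first by rewrite eqxx.
have [->|c0] := eqVneq c 0; last first.
  move=> _; rewrite rmorphD rmorphM /= map_polyX map_polyC hornerMXaddC => /pp' h.
  exists c; split=> //; move: h; rewrite rpredDl //.
  by rewrite idealMr.
rewrite addr0 => h; have Q0 : Q != 0 by apply: contraNneq h => ->; rewrite mul0r.
rewrite rmorphM /= map_polyX hornerMX prime_idealrM (negPf ap) orbF.
exact: IH.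
Qed.
End TrailingCoefficient.

(* Lowest terms of an algebraic relation between elements a_i of              *)
(* p_(i+1) \ p_i, taken one variable at a time, end with a unit in p_3.       *)
Lemma no_prime_chain3 (k : fieldType) (T : comNzRingType) (iota : {rmorphism k -> T})
    (p : nat -> prime_idealr T) :
  prime_chain p 3 ->
  (forall a0 a1 a2 : T, a0 \notin (p 0%N : pred T) ->
    a1 \notin (p 1%N : pred T) -> a2 \notin (p 2 : pred T) ->
    exists u0 u1 u2 N, exists c : 'I_N * 'I_N * 'I_N -> k,
    [/\ exists v0 v1 v2, [/\ v0 * u0 = 1, v1 * u1 = 1 & v2 * u2 = 1], exists x, c x != 0 &
     \sum_x iota (c x) * ((u0 * a0) ^+ x.1.1 * (u1 * a1) ^+ x.1.2 * (u2 * a2) ^+ x.2)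
        \in (p 0%N : pred T)]) -> False.
Proof.
move=> chp dep.
have sub i : (i < 3)%N -> {subset (p i : pred T) <= (p i.+1 : pred T)}.
  by move=> /chp [h _] x xp; apply: h.
have ex i : (i < 3)%N -> exists a, a \in (p i.+1 : pred T) /\ a \notin (p i : pred T).
  move=> /chp [_ h]; apply: contrapT => no; apply: h => x /= xp.
  by apply: contrapT => /negP xq; apply: no; exists x.
have [//|b0 [b0p b0n]] := ex 0%N; have [//|b1 [b1p b1n]] := ex 1%N.
have [//|b2 [b2p b2n]] := ex 2.
have unitM (P : prime_idealr T) v u b : v * u = 1 ->
    (u * b \in (P : pred T)) = (b \in (P : pred T)).
  move=> vu; rewrite prime_idealrM; case uP: (u \in _) => //.
  by have := idealr1 P; rewrite -vu idealMr.
have [u0 [u1 [u2 [N [c [[v0 [v1 [v2 [e0 e1 e2]]]] [x cx] hc]]]]]] := dep _ _ _ b0n b1n b2n.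
pose a0 := u0 * b0; pose a1 := u1 * b1; pose a2 := u2 * b2.
have cm2 : commr_rmorph iota a2 by move=> y; apply: mulrC.
pose ev2 : {rmorphism _ -> T} := horner_morph cm2.
have cm1 : commr_rmorph ev2 a1 by move=> y; apply: mulrC.
pose ev1 : {rmorphism _ -> T} := horner_morph cm1.
(* The relation is written with nested variables, the outermost standing for [a0] and the innermost
   for [a2], the order in which the chain of primes strips them off. *)
pose pc i j : {poly k} := \sum_(l < N) c (i, j, l) *: 'X^l.
pose qc i : {poly {poly k}} := \sum_(j < N) pc i j *: 'X^j.
pose Q : {poly {poly {poly k}}} := \sum_(i < N) qc i *: 'X^i.
have coefS (B : comNzRingType) (f : 'I_N -> B) (i : 'I_N) :
    (\sum_(j < N) f j *: 'X^j)`_i = f i.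
  rewrite coef_sum (bigD1 i) //= coefZ coefXn eqxx mulr1 big1 ?addr0 // => j ji.
  by rewrite coefZ coefXn eq_sym (inj_eq val_inj) (negPf ji) mulr0.
have hornerS (B : comNzRingType) (f : {rmorphism B -> T}) (u : T) (g : 'I_N -> B) :
    (map_poly f (\sum_(j < N) g j *: 'X^j)).[u] = \sum_(j < N) f (g j) * u ^+ j.
  rewrite rmorph_sum horner_sum; apply: eq_bigr => j _ /=.
  by rewrite map_polyZ hornerZ map_polyXn hornerXn.
have Q0 : Q != 0.
  apply: contraNneq cx => Q0; have := coefS _ qc x.1.1; rewrite -/Q Q0 coef0 => /esym q0.
  have := coefS _ (pc x.1.1) x.1.2; rewrite -/(qc _) q0 coef0 => /esym p0.
  have := coefS _ (fun l => c (x.1.1, x.1.2, l)) x.2; rewrite -/(pc _ _) p0 coef0.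
  by case: x {q0 p0} => -[i j] l /= <-.
have evQ : (map_poly ev1 Q).[a0] \in (p 0%N : pred T).
  suff -> : (map_poly ev1 Q).[a0] =
     \sum_x iota (c x) * (a0 ^+ x.1.1 * a1 ^+ x.1.2 * a2 ^+ x.2) by [].
  transitivity (\sum_(i < N) \sum_(j < N) \sum_(l < N)
      iota (c (i, j, l)) * (a0 ^+ i * a1 ^+ j * a2 ^+ l)); last first.
    by rewrite pair_bigA pair_bigA; apply: eq_bigr => -[[i j] l].
  rewrite hornerS; apply: eq_bigr => i _.
  have -> : ev1 (qc i) = \sum_(j < N) ev2 (pc i j) * a1 ^+ j by exact: hornerS.
  rewrite mulr_suml; apply: eq_bigr => j _.
  have -> : ev2 (pc i j) = \sum_(l < N) iota (c (i, j, l)) * a2 ^+ l by exact: hornerS.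
  by rewrite !mulr_suml; apply: eq_bigr => l _; ring.
have [||q [q0 qp]] := trailing_coefficient Q0 (sub 0%N isT) _ _ evQ.
- by rewrite (unitM _ _ _ _ e0).
- by rewrite (unitM _ _ _ _ e0).
have [||r [r0 rp]] := trailing_coefficient (ev := ev2) q0 (sub 1%N isT) _ _ qp.
- by rewrite (unitM _ _ _ _ e1).
- by rewrite (unitM _ _ _ _ e1).
have [||z [z0 zp]] := trailing_coefficient (ev := iota) r0 (sub 2 isT) _ _ rp.
- by rewrite (unitM _ _ _ _ e2).
- by rewrite (unitM _ _ _ _ e2).
have := idealr1 (p 3); rewrite -(rmorph1 iota) -(mulVf z0) rmorphM.
by rewrite idealMr.
Qed.

(** * Zariski's lemma in two variables *)

Section Zariski.
Variables (k : fieldType) (K : comNzRingType) (rho : {rmorphism {poly k} -> K}) (eta : K).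
Hypothesis K_field : forall z : K, z != 0 -> exists w, z * w = 1.
Hypothesis K_gen : forall z : K, exists p : {poly {poly k}}, z = (map_poly rho p).[eta].

Lemma integral_exp y n : integralOver rho y -> integralOver rho (y ^+ n).
Proof.
move=> hy; elim: n => [|n IH]; first exact: integral1.
by rewrite exprS; apply: integral_mul.
Qed.

(** With c the leading coefficient and [d + 1] the degree, multiplying the equation of [eta] by the
    image of [c ^ d] makes it monic in c times [eta]. *)
Lemma integral_lead_coef_mul (p : {poly {poly k}}) : (1 < size p)%N ->
  (map_poly rho p).[eta] = 0 -> integralOver rho (rho (lead_coef p) * eta).
Proof.
move=> sp p_eta; set c := lead_coef p.
pose d := (size p).-2; have spE : size p = d.+2 by rewrite /d; case: (size p) sp => [|[]].
pose r : {poly {poly k}} := \poly_(i < d.+1) (p`_i * c ^+ (d - i)).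
exists ('X^(d.+1) + r).
  rewrite monicE lead_coefDl ?lead_coefXn // size_polyXn ltnS.
  exact: size_poly.
rewrite /root rmorphD /= map_polyXn hornerD hornerXn.
rewrite [r]poly_def rmorph_sum horner_sum.
have -> : (rho c * eta) ^+ d.+1 + \sum_(i < d.+1)
    (map_poly rho ((p`_i * c ^+ (d - i)) *: 'X^i)).[rho c * eta] =
    rho c ^+ d * (map_poly rho p).[eta].
  rewrite -[in RHS](coefK p) [in RHS]poly_def spE rmorph_sum horner_sum mulr_sumr [in
    RHS]big_ord_recr /= addrC.
  congr (_ + _).
    rewrite map_polyZ hornerZ map_polyXn hornerXn exprMn /c lead_coefE spE /= exprSr.
    by ring.
  apply: eq_bigr => i _; rewrite !map_polyZ !hornerZ !map_polyXn !hornerXn.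
  rewrite rmorphM rmorphXn exprMn.
  have -> : rho c ^+ d = rho c ^+ (d - i) * rho c ^+ i by rewrite -exprD subnK // -ltnS.
  by ring.
by rewrite p_eta mulr0.
Qed.

(** If [rho] were injective, [eta] would be algebraic over [{poly k}], with some leading coefficient
    [c], and every element of [K] would become integral after multiplication by a power of [c]. For
    the inverse of [u = 1 + 'X * c] this makes [u] divide a power of [c], although [u] is coprime to
    [c] and not constant. *)
Lemma zariski_two : exists phi : {poly k}, phi != 0 /\ rho phi = 0.
Proof.
apply: contrapT => no.
have inj phi : rho phi = 0 -> phi = 0.
  by move=> h; apply/eqP; apply: contrapT => /negP phi0; apply: no; exists phi.
have [p [p0 p_eta]] : exists p, p != 0 /\ (map_poly rho p).[eta] = 0.
  have [->|eta0] := eqVneq eta 0.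
    by exists 'X; rewrite polyX_eq0 map_polyX hornerX.
  have [w ew] := K_field eta0; have [q qw] := K_gen w.
  (* The inverse of [eta] is itself a polynomial [q] in [eta]; the relation is non-zero because its
     constant coefficient is -1. *)
  exists ('X * q - 1); split.
    apply/eqP => /(congr1 (coefp 0)); rewrite /= coefB coefXM coef1 coef0 /= sub0r.
    by move/eqP; rewrite oppr_eq0 oner_eq0.
  by rewrite rmorphB rmorphM rmorph1 /= map_polyX hornerD hornerN hornerC mulrC hornerMX
    -qw mulrC ew subrr.
set c := lead_coef p.
have c0 : c != 0 by rewrite lead_coef_eq0.
have sp : (1 < size p)%N.
  rewrite ltnNge; apply/negP => /size1_polyC pE.
  move: p_eta; rewrite pE map_polyC hornerC => /inj p00.
  by move: p0; rewrite pE p00 eqxx.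
have int_c_eta := integral_lead_coef_mul sp p_eta; rewrite -/c in int_c_eta.
pose u : {poly k} := 1 + 'X * c.
have su : size u = (size c).+1.
  rewrite /u addrC mulrC size_polyDl size_mulX // size_poly1 ltnS size_poly_gt0 //.
have u0 : rho u != 0.
  by apply/eqP => /inj u0; move: su; rewrite u0 size_poly0.
have [w uw] := K_field u0; have [q qw] := K_gen w.
pose N := size q; pose z := rho c ^+ N * w.
have [P monP] : integralOver rho z.
  rewrite /z qw -[X in map_poly _ X](coefK q) poly_def rmorph_sum horner_sum mulr_sumr.
  apply: (big_ind (integralOver rho)); [exact: integral0|exact: integral_add|].
  move=> i _; rewrite /= map_polyZ hornerZ map_polyXn hornerXn.
  have -> : rho c ^+ N * (rho q`_i * eta ^+ i) =
            rho (c ^+ (N - i) * q`_i) * (rho c * eta) ^+ i.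
    rewrite rmorphM rmorphXn exprMn.
    have -> : rho c ^+ N = rho c ^+ (N - i) * rho c ^+ i.
      by rewrite -exprD subnK // ltnW.
    by ring.
  by apply: integral_mul; [apply: integral_id|apply: integral_exp].
rewrite /root => /eqP Pz.
pose m := (size P).-1; have sP : size P = m.+1.
  by rewrite /m prednK // size_poly_gt0 monic_neq0.
have zu : z * rho u = rho (c ^+ N) by rewrite /z -mulrA [w * _]mulrC uw mulr1 rmorphXn.
(* The monic equation of [z] times [rho u ^ m] is free of denominators, since
   [z * rho u = rho (c ^ N)]. Injectivity turns it into an identity in [{poly k}], where every term
   but [c ^ (N * m)] is divisible by [u]. *)
have : rho (\sum_(i < m.+1) P`_i * c ^+ (N * i) * u ^+ (m - i)) = 0.
  rewrite rmorph_sum /= -[RHS](mul0r (rho u ^+ m)) -[X in _ = X * _]Pz -[X in map_poly _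
    X](coefK P) sP poly_def.
  rewrite rmorph_sum horner_sum mulr_suml; apply: eq_bigr => i _.
  rewrite /= map_polyZ hornerZ map_polyXn hornerXn !rmorphM -!mulrA; congr (_ * _).
  rewrite exprM rmorphXn -zu exprMn -mulrA; congr (_ * _).
  by rewrite rmorphXn -exprD subnKC // -ltnS.
move/inj; rewrite big_ord_recr /= subnn expr0 mulr1.
have -> : P`_m = 1 by move/monicP: monP; rewrite lead_coefE.
rewrite mul1r addrC => /eqP; rewrite addr_eq0 => /eqP cE.
have udc : u %| c ^+ (N * m).
  rewrite cE dvdpNr; apply: (big_ind (fun y => u %| y)); [exact: dvdp0|by move=> *;
    apply: dvdp_add|].
  move=> i _.
  have -> : (m - i)%N = (m - i).-1.+1 by have := ltn_ord i; lia.
  by rewrite exprS dvdp_mull // dvdp_mulr.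
have cuc : coprimep u (c ^+ (N * m)).
  apply: coprimep_expr; apply/coprimepP => d du dc.
  have : d %| 1 by rewrite -(addrK ('X * c) 1) -/u dvdp_sub // dvdp_mull.
  by rewrite dvdp1 size_poly_eq1.
have := coprimep_dvdl udc cuc; rewrite coprimepp su eqSS size_poly_eq0.
exact/negP.
Qed.
End Zariski.

(** * Squares of edge primes *)

Section MpolyInd.
Variables (k : fieldType) (n : nat).

Lemma mpoly_subring_ind (P : {mpoly k[n]} -> Prop) :
  (forall c, P c%:MP) -> (forall i, P 'X_i) ->
  (forall p q, P p -> P q -> P (p + q)) -> (forall p q, P p -> P q -> P (p * q)) ->
  forall p, P p.
Proof.
move=> PC PX PD PM; elim/mpolyind => [|c m p _ _ Pp]; first by rewrite -mpolyC0.
apply: (PD) => //; rewrite -mul_mpolyC; apply: (PM) => //.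
rewrite mpolyXE_id; apply: (big_ind P) => [|//|i _]; first by rewrite -mpolyC1.
elim: (m i) => [|e IH]; first by rewrite expr0 -mpolyC1.
by rewrite exprS; apply: PM.
Qed.

End MpolyInd.

Section Plane.
Variables (k : fieldType) (n : nat) (i j : 'I_n).
Hypothesis ij : i != j.
Local Notation S := {mpoly k[n]}.
Local Notation K2 := {poly {poly k}}.

(* Restriction to the plane of x_i and x_j, in the coordinates s = x_i + x_j  *)
(* (the inner variable) and y = x_j (the outer one).                          *)
Definition plane_coord (t : 'I_n) : K2 :=
  if t == i then ('X : {poly k})%:P - 'X else if t == j then 'X else 0.

Definition plane : S -> K2 := mmap (polyC \o polyC) plane_coord.
HB.instance Definition _ := GRing.RMorphism.on plane.

Lemma planeC c : plane c%:MP = c%:P%:P. Proof. exact: mmapC. Qed.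

Lemma planeD : {morph plane : f g / f + g}. Proof. exact: rmorphD. Qed.

Lemma planeB : {morph plane : f g / f - g}. Proof. exact: rmorphB. Qed.

Lemma planeM : {morph plane : f g / f * g}. Proof. exact: rmorphM. Qed.

Lemma planeX t : plane 'X_t = plane_coord t.
Proof. by rewrite /plane mmapX mmap1U. Qed.

Lemma planeXl : plane 'X_i = ('X : {poly k})%:P - 'X.
Proof. by rewrite planeX /plane_coord eqxx. Qed.

Lemma planeXr : plane 'X_j = 'X.
Proof. by rewrite planeX /plane_coord eq_sym (negPf ij) eqxx. Qed.

Lemma planeX0 t : t != i -> t != j -> plane 'X_t = 0.
Proof. by move=> ti tj; rewrite planeX /plane_coord (negPf ti) (negPf tj). Qed.

Lemma plane_derivM t f g :
  plane (f * g)^`M(t) = plane f^`M(t) * plane g + plane f * plane g^`M(t).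
Proof. by rewrite mderivM planeD !planeM. Qed.

Lemma plane_deriv_sumX (g : 'I_n -> S) t : t != i -> t != j ->
  plane (\sum_(u | (u != i) && (u != j)) g u * 'X_u)^`M(t) = plane (g t).
Proof.
move=> ti tj; rewrite linear_sum rmorph_sum /= (bigD1 t) /=; last by rewrite ti.
have dX u : plane (g u * 'X_u)^`M(t) = plane (g u)^`M(t) * plane 'X_u + plane (g u) * (u == t)%:R.
  rewrite plane_derivM mderivX mnm1E; congr (_ + _ * _).
  have [->|ut] := eqVneq u t; last by rewrite scale0r rmorph0.
  by rewrite scale1r -{1}[U_(t)%MM]add0m addmK mpolyX0 rmorph1.
rewrite dX eqxx mulr1 planeX0 // mulr0 add0r big1 ?addr0 // => u /andP[/andP[ui uj] /negPf ut].
by rewrite dX ut mulr0 planeX0 // mulr0 addr0.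
Qed.

Lemma commr_sum_coord : commr_rmorph (mpolyC n (R := k)) ('X_i + 'X_j : S).
Proof. by move=> c; apply: mulrC. Qed.

Definition lift_sum : {poly k} -> S := horner_morph commr_sum_coord.
HB.instance Definition _ := GRing.RMorphism.on lift_sum.

Lemma commr_lift_sum : commr_rmorph lift_sum ('X_j : S).
Proof. by move=> c; apply: mulrC. Qed.

(** A ring section of [plane]: the inner variable goes to x_i + x_j and the outer one to x_j. *)
Definition plane_lift : K2 -> S := horner_morph commr_lift_sum.
HB.instance Definition _ := GRing.RMorphism.on plane_lift.

Lemma lift_sumK q : plane (lift_sum q) = q%:P.
Proof.
elim/poly_ind: q => [|q c IH]; first by rewrite rmorph0 polyC0 rmorph0.
rewrite !(rmorphD, rmorphM) /= IH.
have -> : lift_sum 'X = 'X_i + 'X_j by exact: horner_morphX.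
have -> : lift_sum c%:P = c%:MP by exact: horner_morphC.
by rewrite rmorphD /= planeXl planeXr planeC subrK.
Qed.

Lemma plane_liftK q : plane (plane_lift q) = q.
Proof.
elim/poly_ind: q => [|q c IH]; first by rewrite !rmorph0.
rewrite !(rmorphD, rmorphM) /= IH.
have -> : plane_lift 'X = 'X_j by exact: horner_morphX.
have -> : plane_lift c%:P = lift_sum c by exact: horner_morphC.
by rewrite planeXr lift_sumK.
Qed.

Lemma edge_prime_ideal : is_ideal (edge_prime k i j).
Proof. exact: is_ideal_gen. Qed.

Lemma edge_primeX t : t != i -> t != j -> edge_prime k i j 'X_t.
Proof. by move=> ti tj; apply: ideal_gen_in; exists t. Qed.

(** It suffices to look at constants and variables, both maps being ring morphisms. Hence
    [edge_prime] is the kernel of [plane]. *)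
Lemma sub_plane_lift f : edge_prime k i j (f - plane_lift (plane f)).
Proof.
have [P0 PD PM] := edge_prime_ideal.
elim/mpoly_subring_ind: f => [c|t|p q hp hq|p q hp hq].
- rewrite planeC.
  have -> : plane_lift c%:P%:P = lift_sum c%:P by exact: horner_morphC.
  have -> : lift_sum c%:P = c%:MP by exact: horner_morphC.
  by rewrite subrr.
- have liftX : plane_lift 'X = 'X_j by exact: horner_morphX.
  have [->|ti] := eqVneq t i.
    rewrite planeXl rmorphB /= liftX.
    have -> : plane_lift ('X)%:P = lift_sum 'X by exact: horner_morphC.
    have -> : lift_sum 'X = 'X_i + 'X_j by exact: horner_morphX.
    by rewrite addrK subrr.
  have [->|tj] := eqVneq t j; first by rewrite planeXr liftX subrr.
  by rewrite planeX0 // rmorph0 subr0; apply: edge_primeX.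
- by rewrite !rmorphD /= opprD addrACA; apply: PD.
rewrite !rmorphM /=.
set p' := plane_lift _; set q' := plane_lift _.
have -> : p * q - p' * q' = q * (p - p') + p' * (q - q') by ring.
by apply: (PD); apply: (PM).
Qed.

Lemma edge_primeP f : edge_prime k i j f <-> plane f = 0.
Proof.
split=> [|f0]; last first.
  by have := sub_plane_lift f; rewrite f0 rmorph0 subr0.
apply: (@ideal_gen_min _ _ [set f | plane f = 0]) => [|_ [t [ti tj ->]]].
  split=> /=; first by rewrite rmorph0.
    by move=> x y hx hy; rewrite rmorphD /= hx hy addr0.
  by move=> a x hx; rewrite rmorphM /= hx mulr0.
exact: planeX0.
Qed.

Lemma edge_prime_expand f : edge_prime k i j f ->
  exists g : 'I_n -> S, f = \sum_(t | (t != i) && (t != j)) g t * 'X_t.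
Proof.
apply: (@ideal_gen_min _ _ [set f | exists g : 'I_n -> S, f = \sum_(t | (t != i) && (t !=
  j)) g t * 'X_t]).
  split=> /=.
  - by exists (fun=> 0); rewrite big1 // => t _; rewrite mul0r.
  - move=> _ _ [g ->] [h ->]; exists (fun t => g t + h t).
    by rewrite -big_split; apply: eq_bigr => t _; rewrite mulrDl.
  - move=> a _ [g ->]; exists (fun t => a * g t).
    by rewrite mulr_sumr; apply: eq_bigr => t _; rewrite mulrA.
move=> _ [t [ti tj ->]]; exists (fun u => if u == t then 1 else 0).
rewrite (bigD1 t) /=; last by rewrite ti.
rewrite eqxx mul1r big1 ?addr0 // => u /andP[_ /negPf ->].
by rewrite mul0r.
Qed.

Definition edge_square : set S := ideal_pow (edge_prime k i j) 2.

Lemma edge_square_ideal : is_ideal edge_square.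
Proof. exact: is_ideal_gen. Qed.

Lemma edge_squareM f g : edge_prime k i j f -> edge_prime k i j g -> edge_square (f * g).
Proof.
move=> hf hg; apply: ideal_gen_in; exists (fun u => if u == 0 then f else g).
split; first by move=> u; case: ifP.
by rewrite big_ord_recl big_ord_recl big_ord0 mulr1.
Qed.

Lemma edge_square_sub (I : set S) : is_ideal I ->
  (forall f g, edge_prime k i j f -> edge_prime k i j g -> I (f * g)) -> edge_square `<=` I.
Proof.
move=> idI h; apply: ideal_gen_min => // _ [f [hf ->]].
by rewrite big_ord_recl big_ord_recl big_ord0 mulr1; apply: h.
Qed.

(** An element of P is a sum of terms [g t * 'X_t] over the off-edge variables, and its derivative
    in x_t restricts to [plane (g t)]. So P / P^2 is free over the plane ring on these variables,
    with the derivatives as coordinates. *)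
Lemma edge_square_derivP f : edge_square f <->
  plane f = 0 /\ forall t, t != i -> t != j -> plane f^`M(t) = 0.
Proof.
split=> [|[f0 df0]]; last first.
  have /edge_prime_expand[g fE] : edge_prime k i j f by apply/edge_primeP.
  rewrite fE; apply: is_ideal_sum_cond; first exact: edge_square_ideal.
  move=> t /andP[ti tj].
  apply: edge_squareM; last exact: edge_primeX.
  by apply/edge_primeP; rewrite -(df0 _ ti tj) fE plane_deriv_sumX.
apply: (@edge_square_sub [set f | plane f = 0 /\ forall t, t != i -> t != j -> plane
  f^`M(t) = 0]).
  split=> /=.
  - by split=> [|t _ _]; rewrite ?mderiv0 rmorph0.
  - move=> x y [x0 dx0] [y0 dy0]; split=> [|t ti tj].
      by rewrite rmorphD /= x0 y0 addr0.
    by rewrite mderivD rmorphD /= dx0 // dy0 // addr0.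
  - move=> a x [x0 dx0]; split=> [|t ti tj]; first by rewrite rmorphM /= x0 mulr0.
    by rewrite mderivM rmorphD !rmorphM /= x0 dx0 // !mulr0 addr0.
move=> g h /edge_primeP g0 /edge_primeP h0; split=> [|t _ _] /=.
  by rewrite rmorphM /= g0 mul0r.
by rewrite mderivM rmorphD !rmorphM /= g0 h0 mul0r mulr0 addr0.
Qed.

End Plane.

Section Weight.
Variables (k : fieldType) (n : nat).
Local Notation S := {mpoly k[n]}.
Implicit Types (i j t : 'I_n) (m : 'X_{1..n}) (f g : S).

(** The case [i = j] is meaningful too: it is the degree off a single variable, as used in
    [axis_regular]. *)
Definition weight i j m : nat := (\sum_(t | (t != i) && (t != j)) m t)%N.

Lemma weightD i j m1 m2 : weight i j (m1 + m2)%MM = (weight i j m1 + weight i j m2)%N.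
Proof. by rewrite /weight -big_split; apply: eq_bigr => t _; rewrite mnmDE. Qed.

Lemma weight_mdeg i j m : i != j -> (mdeg m = m i + m j + weight i j m)%N.
Proof.
move=> ij; rewrite mdegE (bigD1 i) //= (bigD1 j) /=; last by rewrite eq_sym.
by rewrite addnA.
Qed.

Definition order_ge i j (r : nat) : set S :=
  [set f | forall m, f@_m != 0 -> (r <= weight i j m)%N].

Lemma order_geM i j r s f g :
  order_ge i j r f -> order_ge i j s g -> order_ge i j (r + s) (f * g).
Proof.
move=> hf hg m; rewrite -mcoeff_msupp => /msuppM_le /allpairsP[[m1 m2] /= [h1 h2 ->]].
by rewrite weightD leq_add // ?hf ?hg // -mcoeff_msupp.
Qed.

Lemma is_ideal_order_ge i j r : is_ideal (order_ge i j r).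
Proof.
split.
- by move=> m; rewrite mcoeff0 eqxx.
- move=> f g hf hg m fg; have [f0|/hf //] := eqVneq f@_m 0.
  by apply: hg; move: fg; rewrite mcoeffD f0 add0r.
- by move=> a f hf; rewrite -[r]add0n; apply: order_geM.
Qed.

Lemma edge_prime_order i j f : edge_prime k i j f -> order_ge i j 1 f.
Proof.
apply: ideal_gen_min; first exact: is_ideal_order_ge.
move=> _ [t [ti tj ->]] m; rewrite mcoeffX; have [<- _|] := eqVneq U_(t)%MM m;
  last by rewrite eqxx.
by rewrite /weight (bigD1 t) ?ti //= mnm1E eqxx.
Qed.

Lemma monomial_factor i j m : (0 < weight i j m)%N ->
  exists t, [/\ t != i, t != j & m = (m - U_(t) + U_(t))%MM].
Proof.
move=> h; have /existsP[t /and3P[ti tj mt]] : [exists t, [&& t != i, t != j & m t != 0%N]].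
  apply: contraLR h; rewrite negb_exists => /forallP h; rewrite -eqn0Ngt /weight big1 //.
  by move=> t /andP[ti tj]; have := h t; rewrite ti tj /= negbK => /eqP.
by exists t; rewrite submK // lep1mP.
Qed.

(** A monomial of weight at least 2 splits off two off-edge variables, hence lies in P^2; conversely
    orders add up under multiplication. *)
Lemma edge_square_weightP i j f : edge_square i j f <->
  forall m, (weight i j m <= 1)%N -> f@_m = 0.
Proof.
split=> [hf m wm|hf].
  apply: contraTeq wm; rewrite -ltnNge; move: m.
  apply: (@edge_square_sub _ _ _ _ (order_ge i j 2)) hf; first exact: is_ideal_order_ge.
  by move=> g h /edge_prime_order hg /edge_prime_order hh; apply: (order_geM hg hh).
rewrite (mpolyE f); apply: is_ideal_sum; first exact: edge_square_ideal.
move=> m; rewrite mcoeff_msupp => fm.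
have wm : (1 < weight i j m)%N by rewrite ltnNge; apply: contra fm => /hf ->.
have [|t [ti tj mE]] := @monomial_factor i j m; first exact: ltnW.
have [|u [ui uj uE]] := @monomial_factor i j (m - U_(t))%MM.
  have : weight i j U_(t)%MM = 1%N.
    rewrite /weight (bigD1 t) ?ti //= mnm1E eqxx big1 // => v /andP[_ vt].
    by rewrite mnm1E eq_sym (negPf vt).
  by move: wm; rewrite {1}mE weightD => + e; rewrite e addn1.
have [_ _ PM] := edge_square_ideal k i j.
rewrite mE uE !mpolyXD -mul_mpolyC -mulrA; apply: (PM); apply: (PM).
by apply: edge_squareM; apply: edge_primeX.
Qed.

Definition axis i : S -> {poly k} := mmap polyC (fun t => if t == i then 'X else 0).
HB.instance Definition _ i := GRing.RMorphism.on (axis i).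

Lemma axis_coef i f : axis i f != 0 -> exists q, f@_(U_(i) *+ q)%MM != 0.
Proof.
move=> h; apply: contrapT => no; move/eqP: h; apply.
rewrite /axis /mmap big_seq big1 // => m; rewrite mcoeff_msupp => fm.
have [t /andP[ti mt]] : exists t, (t != i) && (m t != 0%N).
  apply: contrapT => nt; apply: no; exists (m i).
  suff -> : (U_(i) *+ m i)%MM = m by [].
  apply/mnmP => t; rewrite mulmnE mnm1E eq_sym.
  have [->|ti] := eqVneq; first by rewrite mul1n.
  by rewrite mul0n; apply/esym/eqP; apply: contrapT => mt; apply: nt; exists t;
    rewrite ti /=; apply/negP.
rewrite /mmap1 (bigD1 t) //= (negPf ti); case: (m t) mt => // e _.
by rewrite expr0n mul0r mulr0.
Qed.

(* Compare the coefficients at the monomial x_i^q m, where x_i^q is the       *)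
(* largest pure power of x_i in f and m has, among the monomials of h in B of *)
(* least degree off x_i, the largest exponent of x_i.                         *)
Lemma axis_regular i (B : 'X_{1..n} -> Prop) f h :
  (forall m m', (forall t, t != i -> (m' t <= m t)%N) -> B m -> B m') ->
  axis i f != 0 -> (forall m, B m -> (f * h)@_m = 0) ->
  forall m, B m -> h@_m = 0.
Proof.
move=> downB /axis_coef[q0 fq0] fh0.
have [q fq qmax] : exists2 q, f@_(U_(i) *+ q)%MM != 0 &
    forall q', f@_(U_(i) *+ q')%MM != 0 -> (q' <= q)%N.
  have ex : exists q, f@_(U_(i) *+ q)%MM != 0 by exists q0.
  have ub q' : f@_(U_(i) *+ q')%MM != 0 -> (q' <= msize f)%N.
    rewrite -mcoeff_msupp => /msize_mdeg_lt; rewrite mdegMn mdeg1 mul1n; exact: ltnW.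
  by exists (ex_maxn ex ub); case: ex_maxnP.
pose off m := weight i i m.
suff main d : forall m, off m = d -> B m -> h@_m = 0 by move=> m; apply: (main (off m)).
elim/ltn_ind: d => d IH m1 m1d Bm1; apply/eqP; apply: contrapT => /negP hm1.
pose good e := has (fun m => [forall t, (t != i) ==> (m t == m1 t)] && (m i == e)) (msupp h).
have exg : exists e, good e.
  exists (m1 i); apply/hasP; exists m1; first by rewrite mcoeff_msupp.
  by rewrite eqxx andbT; apply/forallP => t; rewrite eqxx implybT.
have ubg e : good e -> (e <= msize h)%N.
  move=> /hasP[m /msize_mdeg_lt mh /andP[_ /eqP <-]]; apply: leq_trans (ltnW mh).
  by rewrite mdegE (bigD1 i) //= leq_addr.
have [e /hasP[m mh /andP[/forallP mm1 /eqP me]] emax] := ex_maxnP exg ubg.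
have m_off t : t != i -> m t = m1 t by move=> ti; apply/eqP; have := mm1 t; rewrite ti.
have Bm : B m by apply: downB Bm1 => t ti; rewrite m_off.
have offE m' : (forall t, t != i -> m' t = m1 t) -> off m' = d.
  by move=> hm'; rewrite -m1d; apply: eq_bigr => t /andP[ti _]; rewrite hm'.
have BqM : B (U_(i) *+ q + m)%MM.
  by apply: downB Bm => t ti; rewrite mnmDE mulmnE mnm1E eq_sym (negPf ti) mul0n.
have := fh0 _ BqM; rewrite (mcoeffM) => /eqP; apply/negP.
have dq : (mdeg (U_(i) *+ q)%MM < (mdeg (U_(i) *+ q + m)%MM).+1)%N.
  by rewrite ltnS mdegD leq_addr.
have dm : (mdeg m < (mdeg (U_(i) *+ q + m)%MM).+1)%N by rewrite ltnS mdegD leq_addl.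
rewrite (bigD1 (BMultinom dq, BMultinom dm)) //= big1 ?addr0.
  by rewrite mulf_neq0 // -mcoeff_msupp.
(* Any other contributing pair [k1], [k2] is excluded. The exponents of [k2] off x_i are at most
   those of [m1], so minimality of [d] makes them equal and [k1] a pure power of x_i; maximality of
   [q] and [e] then leaves the chosen pair. *)
move=> [[k1 b1] [k2 b2]] /= /andP[/eqP kE kne]; apply/eqP; rewrite mulf_eq0.
have [//|fk1] := eqVneq f@_k1 0; have [//|hk2] := eqVneq h@_k2 0.
have kt t : (k1 t + k2 t = (i == t) * q + m t)%N.
  by rewrite -mnmDE -kE mnmDE mulmnE mnm1E.
have k2_le t : t != i -> (k2 t <= m1 t)%N.
  by move=> ti; have := kt t; rewrite eq_sym (negPf ti) mul0n add0n m_off //; lia.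
have Bk2 : B k2 by apply: downB Bm1 => t ti; apply: k2_le.
have offk2 : off k2 = d.
  apply/eqP; rewrite eqn_leq; apply/andP; split.
    by rewrite -m1d; apply: leq_sum => t /andP[ti _]; apply: k2_le.
  rewrite leqNgt; apply/negP => lt; have := IH _ lt _ erefl Bk2.
  by apply/eqP.
have k2_off t : t != i -> k2 t = m1 t.
  move=> ti; move: offk2; rewrite -m1d /off /weight (bigD1 t) ?ti //= [in RHS](bigD1 t) ?ti //=.
  have : (\sum_(u | (u != i) && (u != i) && (u != t)) k2 u <=
          \sum_(u | (u != i) && (u != i) && (u != t)) m1 u)%N.
    by apply: leq_sum => u /andP[/andP[ui _] _]; apply: k2_le.
  set a := (X in (X <= _)%N -> _); set b := (X in (_ <= X)%N -> _) => ab sE.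
  by apply/eqP; rewrite eqn_leq k2_le //= -(leq_add2r a) sE leq_add2l.
have k1_off t : t != i -> k1 t = 0%N.
  by move=> ti; have := kt t; rewrite k2_off // m_off // eq_sym (negPf ti); lia.
have k1E : k1 = (U_(i) *+ k1 i)%MM.
  apply/mnmP => t; rewrite mulmnE mnm1E eq_sym; have [->|ti] := eqVneq t i;
    first by rewrite mul1n.
  by rewrite k1_off.
have le1 : (k1 i <= q)%N by apply: qmax; rewrite -k1E.
have le2 : (k2 i <= e)%N.
  apply: emax; apply/hasP; exists k2; first by rewrite mcoeff_msupp.
  by rewrite eqxx andbT; apply/forallP => t; apply/implyP => ti; rewrite k2_off.
have := kt i; rewrite eqxx mul1n me => sumE.
case/negP: kne; rewrite -pair_eqE /=; apply/andP; split; rewrite -val_eqE /=.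
  by rewrite k1E; apply/eqP; congr (_ *+ _)%MM; lia.
apply/eqP/mnmP => t; have [->|ti] := eqVneq t i; first by lia.
by rewrite k2_off // m_off.
Qed.

End Weight.

(** * Regular sequences and gluing *)

Section Regularity.
Variables (k : fieldType) (n : nat).
Local Notation S := {mpoly k[n]}.
Local Notation K2 := {poly {poly k}}.
Implicit Types (i j t : 'I_n).

(** The plane ring is a domain: [f] cancels from the restriction of [f * b], and then from its
    off-edge derivatives. *)
Lemma edge_square_regular i j (f b : S) : i != j -> plane i j f != 0 ->
  edge_square i j (f * b) -> edge_square i j b.
Proof.
move=> ij f0 /(edge_square_derivP ij)[+ dfb]; rewrite planeM => /eqP.
rewrite mulf_eq0 (negPf f0) /= => /eqP b0.
apply/(edge_square_derivP ij); split=> // t ti tj; have /eqP := dfb _ ti tj.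
by rewrite plane_derivM b0 mulr0 add0r mulf_eq0 (negPf f0) => /eqP.
Qed.

(** S / P^2 is free over the plane ring on 1 and the off-edge variables, so regularity of the pair
    on the plane carries over: the quotient [d] is found for the value of [b] first, then for its
    derivatives. *)
Lemma edge_square_regular2 i j (f g b c : S) : i != j -> plane i j f != 0 ->
  (forall u v : K2, plane i j g * u = plane i j f * v -> exists w, u = plane i j f * w) ->
  edge_square i j (g * b - f * c) -> exists d, edge_square i j (b - f * d).
Proof.
move=> ij f0 reg /(edge_square_derivP ij)[e de].
have [w wE] : exists w, plane i j b = plane i j f * w.
  apply: (reg _ (plane i j c)); have := e.
  by rewrite planeB !planeM => /eqP; rewrite subr_eq0 => /eqP.
(* After this correction [b'] and [c'] both vanish on the plane, so the derivatives of
   [g * b' - f * c'] involve no derivative of [f] or [g]. *)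
pose b' := b - f * plane_lift i j w; pose c' := c - g * plane_lift i j w.
have b'0 : plane i j b' = 0 by rewrite /b' planeB planeM plane_liftK // wE subrr.
have e' : plane i j (g * b' - f * c') = 0.
  rewrite -[RHS]e; congr (plane i j _); rewrite /b' /c'; ring.
have c'0 : plane i j c' = 0.
  apply/eqP; have /eqP := e'; rewrite planeB !planeM b'0 mulr0 sub0r oppr_eq0.
  by rewrite mulf_eq0 (negPf f0).
have dt t : exists w, t != i -> t != j -> plane i j b'^`M(t) = plane i j f * w.
  have [/andP[ti tj]|no] := boolP ((t != i) && (t != j)); last first.
    by exists 0 => ti tj; rewrite ti tj in no.
  have [|w' w'E] := reg (plane i j b'^`M(t)) (plane i j c'^`M(t)); last by exists w'.
  have := de t ti tj.
  have -> : g * b - f * c = g * b' - f * c' by rewrite /b' /c'; ring.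
  rewrite mderivB planeB !plane_derivM b'0 c'0 !mulr0 !add0r => /eqP.
  by rewrite subr_eq0 => /eqP.
have [h hE] := choice dt.
pose d' := \sum_(t | (t != i) && (t != j)) plane_lift i j (h t) * 'X_t.
have d'0 : plane i j d' = 0.
  rewrite rmorph_sum big1 // => t /andP[ti tj].
  by rewrite /= planeM planeX0 // mulr0.
exists (plane_lift i j w + d'); apply/(edge_square_derivP ij).
have -> : b - f * (plane_lift i j w + d') = b' - f * d' by rewrite /b'; ring.
split=> [|t ti tj]; first by rewrite planeB planeM b'0 d'0 mulr0 subrr.
rewrite mderivB planeB plane_derivM d'0 mulr0 add0r hE //.
by rewrite plane_deriv_sumX // plane_liftK // subrr.
Qed.

(** Comparing leading coefficients in the outer variable shows that [phi] divides that of [b];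
    subtracting the corresponding term lowers the size of [b]. *)
Lemma monic_regular_mod_const (phi : {poly k}) (g b c : K2) :
  phi != 0 -> lead_coef g \is a GRing.unit ->
  g * b = phi%:P * c -> exists d, b = phi%:P * d.
Proof.
move=> phi0 gu; move: {2}(size b) (leqnn (size b)) => m.
elim: m b c => [|m IH] b c sb e.
  by exists 0; move: sb; rewrite leqn0 size_poly_eq0 => /eqP ->; rewrite mulr0.
have [->|b0] := eqVneq b 0; first by exists 0; rewrite mulr0.
pose a := lead_coef c / lead_coef g; pose q := a%:P * 'X^((size b).-1).
have lb : lead_coef b = phi * a.
  apply: (can_inj (mulrK gu)); rewrite /a -!mulrA mulVr // mulr1 mulrC -lead_coefM e.
  by rewrite lead_coefM lead_coefC.
have [||d dE] := IH (b - phi%:P * q) (c - g * q).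
- rewrite -ltnS; apply: leq_trans sb.
  have -> : b - phi%:P * q = b - lead_coef b *: 'X^((size b).-1).
    by rewrite /q mulrA -polyCM -lb mul_polyC.
  have sb : size b = (size b).-1.+1 by rewrite prednK // size_poly_gt0.
  rewrite {2}sb ltnS; apply/leq_sizeP => j; rewrite coefB coefZ coefXn.
  rewrite leq_eqVlt => /predU1P[<-|jb]; first by rewrite eqxx mulr1 lead_coefE subrr.
  rewrite (gtn_eqF jb) mulr0 subr0; apply: nth_default; rewrite sb //.
- by rewrite !mulrBr e; ring.
by exists (d + q); rewrite mulrDr -dE subrK.
Qed.

End Regularity.

Section Glue.
Variables (k : fieldType) (n : nat) (G : rel 'I_n).
Local Notation S := {mpoly k[n]}.
Implicit Types (i j t : 'I_n).
Hypothesis hG : simple_graph G.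
Hypothesis close : forall s t, s != t -> G s t \/ exists u, G s u /\ G u t.

Lemma edge_neq i j : G i j -> i != j.
Proof. by case: hG => _ irr _ Gij; apply: contraTneq Gij => ->; rewrite irr. Qed.

Lemma symbolic_squareP (f : S) :
  symbolic_power k G 2 f <-> forall i j, G i j -> edge_square i j f.
Proof. by split=> [h i j Gij|h [i j] /= Gij]; [apply: (h (i, j))|apply: h]. Qed.

Lemma is_ideal_symbolic_square : is_ideal (symbolic_power k G 2).
Proof.
split.
- by apply/symbolic_squareP => i j _; case: (@edge_square_ideal k n i j).
- move=> f g /symbolic_squareP hf /symbolic_squareP hg; apply/symbolic_squareP => i j Gij.
  by have [_ + _] := @edge_square_ideal k n i j; apply; [apply: hf|apply: hg].
- move=> a f /symbolic_squareP hf; apply/symbolic_squareP => i j Gij.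
  by have [_ _] := @edge_square_ideal k n i j; apply; apply: hf.
Qed.

Variables (f b : S) (d : 'I_n -> 'I_n -> S).
Hypothesis f_axis : forall i, axis i f != 0.
Hypothesis d_edge : forall i j, G i j -> edge_square i j (b - f * d i j).

(** The product of [f] and [d i j - d i' j'] has no monomial outside both squares. The weights
    ignore the exponent of x_v, so [axis_regular] applies along the x_v-axis, where [f] does not
    vanish. *)
Lemma common_vertex_coef v i j i' j' m : G i j -> G i' j' ->
  (v == i) || (v == j) -> (v == i') || (v == j') ->
  (weight i j m <= 1)%N -> (weight i' j' m <= 1)%N -> (d i j)@_m = (d i' j')@_m.
Proof.
move=> Gij Gij' vij vij' w w'.
apply/eqP; rewrite -subr_eq0 -mcoeffB; apply/eqP.
apply: (@axis_regular k n v (fun m => (weight i j m <= 1)%N /\ (weight i' j' m <= 1)%N) f) => //.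
  have le x y (m1 m2 : 'X_{1..n}) : (v == x) || (v == y) -> (forall t, t != v -> (m2 t <=
    m1 t)%N) ->
      (weight x y m2 <= weight x y m1)%N.
    move=> vxy h; apply: leq_sum => t /andP[tx ty]; apply: h.
    by apply: contraTneq vxy => <-; rewrite negb_or tx ty.
  by move=> m1 m2 h [h1 h2]; split; [apply: leq_trans h1|apply: leq_trans h2]; apply: le.
move=> m1 [w1 w1'].
have -> : f * (d i j - d i' j') = (b - f * d i' j') - (b - f * d i j) by ring.
have /edge_square_weightP h1 := d_edge Gij.
have /edge_square_weightP h2 := d_edge Gij'.
by rewrite mcoeffB h1 // h2 // subrr.
Qed.

(* For a monomial m the edges e with weight_e(m) <= 1 form a connected graph: *)
(* two disjoint ones e, e' have ends s, t carrying the weight of m on e, e',  *)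
(* and every edge at s (at t) again has weight at most 1.                     *)
Lemma small_weight_coef i j i' j' m : G i j -> G i' j' ->
  (weight i j m <= 1)%N -> (weight i' j' m <= 1)%N -> (d i j)@_m = (d i' j')@_m.
Proof.
move=> Gij Gij' w w'; have [symG irrG _] := hG.
have [ii'|ii'] := eqVneq i i'.
  by apply: (@common_vertex_coef i) => //; rewrite -?ii' eqxx ?orbT.
have [ij'|ij'] := eqVneq i j'.
  by apply: (@common_vertex_coef i) => //; rewrite -?ij' eqxx ?orbT.
have [ji'|ji'] := eqVneq j i'.
  by apply: (@common_vertex_coef j) => //; rewrite -?ji' eqxx ?orbT.
have [jj'|jj'] := eqVneq j j'.
  by apply: (@common_vertex_coef j) => //; rewrite -?jj' eqxx ?orbT.
have heavy x y x' y' : G x y -> x != x' -> x != y' -> y != x' -> y != y' ->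
    (weight x y m <= 1)%N -> (weight x' y' m <= 1)%N ->
    exists2 s, (s == x) || (s == y) & mdeg m = (m s + weight x y m)%N.
  move=> Gxy xx xy yx yy wx wx'.
  (* Both ends of the first edge lie off the second, whose weight is at most 1. So one end carries
     the whole exponent of [m] on its edge. *)
  have : (m x + m y <= 1)%N.
    apply: leq_trans wx'; rewrite /weight (bigD1 x) ?xx //= (bigD1 y) /=; last first.
      by rewrite yx yy eq_sym edge_neq.
    by rewrite leq_add2l leq_addr.
  have := weight_mdeg m (edge_neq Gxy) => -> mxy.
  have [mx|mx] := eqVneq (m x) 0%N; first by exists y; rewrite ?eqxx ?orbT //; lia.
  by exists x; rewrite ?eqxx //; lia.
have [s sij ms] := heavy _ _ _ _ Gij ii' ij' ji' jj' w w'.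
have [t tij mt] : exists2 t, (t == i') || (t == j') & mdeg m = (m t + weight i' j' m)%N.
  by apply: (heavy _ _ i j) => //; rewrite eq_sym.
(* By [ms] the degree of [m] off [s] alone is already [weight i j m], and passing to the edge from
   [s] to [x] can only lower it. *)
have light x : G s x -> (weight s x m <= 1)%N.
  by move=> Gsx; have := weight_mdeg m (edge_neq Gsx); lia.
have light' x : G x t -> (weight x t m <= 1)%N.
  by move=> Gxt; have := weight_mdeg m (edge_neq Gxt); lia.
have st : s != t.
  by case/orP: sij => /eqP ->; case/orP: tij => /eqP ->.
case: (close st) => [Gst|[u [Gsu Gut]]].
  transitivity (d s t)@_m; last apply: (@common_vertex_coef t); rewrite ?eqxx ?orbT //.
  - by apply: (@common_vertex_coef s); rewrite ?eqxx ?light.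
  - exact: light.
transitivity (d s u)@_m; first by apply: (@common_vertex_coef s); rewrite ?eqxx ?light.
transitivity (d u t)@_m.
  by apply: (@common_vertex_coef u); rewrite ?eqxx ?orbT ?light ?light'.
by apply: (@common_vertex_coef t); rewrite ?eqxx ?orbT ?light'.
Qed.

(** The coefficient of [d0] at [m] is taken from any edge on which [m] has weight at most 1; by
    [small_weight_coef] the choice does not matter. A monomial with no such edge lies in the
    symbolic square, and 0 is taken there. The sizes of the [d i j] bound the degrees, so [d0] is a
    polynomial. *)
Lemma glue : exists d0, symbolic_power k G 2 (b - f * d0).
Proof.
pose sel m := [pick e : 'I_n * 'I_n | G e.1 e.2 && (weight e.1 e.2 m <= 1)%N].
pose E m : k := if sel m is Some e then (d e.1 e.2)@_m else 0.
have EE i j m : G i j -> (weight i j m <= 1)%N -> E m = (d i j)@_m.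
  move=> Gij w; rewrite /E /sel; case: pickP => [e /andP[Ge we]|/(_ (i, j))].
    exact: small_weight_coef.
  by rewrite /= Gij w.
pose N := (\max_(e : 'I_n * 'I_n) msize (d e.1 e.2))%N.
pose d0 : S := \sum_(m : 'X_{1..n < N}) E m *: 'X_[m].
have d0E m : d0@_m = E m.
  have [mN|Nm] := ltnP (mdeg m) N; first by rewrite mcoeff_mpoly.
  have -> : E m = 0.
    rewrite /E; case: (sel m) => // e; apply: memN_msupp_eq0; apply: msize_mdeg_ge.
    apply: leq_trans Nm; exact: (leq_bigmax (F := fun e : 'I_n * 'I_n => msize (d e.1 e.2))).
  rewrite /d0 raddf_sum big1 // => m' _; rewrite /= mcoeffZ mcoeffX.
  case: eqVneq => [m'm|]; last by rewrite mulr0.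
  by move: Nm; rewrite -m'm leqNgt bmdeg.
exists d0; apply/symbolic_squareP => i j Gij.
have -> : b - f * d0 = (b - f * d i j) + f * (d i j - d0) by ring.
have [_ PD PM] := @edge_square_ideal k n i j.
apply: (PD); first exact: d_edge.
apply: (PM); apply/edge_square_weightP => m w.
by rewrite mcoeffB d0E (EE _ _ _ Gij w) subrr.
Qed.

End Glue.

(** * A regular pair from the first two elementary symmetric polynomials *)

Section Theta.
Variables (k : fieldType) (n : nat).
Local Notation S := {mpoly k[n]}.

Definition theta1 : S := \sum_(t < n) 'X_t.
(** The second elementary symmetric polynomial, which restricts to x_i x_j on the plane of an
    edge. *)
Definition theta2 : S := \sum_(t < n) 'X_t * \sum_(u < n | (u < t)%N) 'X_u.

Definition subst_poly (phi : {poly k}) (x : S) : S := (map_poly (mpolyC n (R := k)) phi).[x].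

Lemma plane_theta1 (i j : 'I_n) : i != j -> plane i j theta1 = ('X)%:P.
Proof.
move=> ij; rewrite /theta1 rmorph_sum (bigD1 i) //= (bigD1 j) /=; last by rewrite eq_sym.
rewrite big1 => [|t /andP[ti tj]]; last exact: planeX0.
by rewrite planeXl // planeXr // addr0 subrK.
Qed.

Lemma plane_theta2 (i j : 'I_n) : i != j ->
  plane i j theta2 = (('X)%:P - 'X) * 'X.
Proof.
move=> ij; pose c (t : 'I_n) := \sum_(u < n | (u < t)%N) plane i j ('X_u : S).
have -> : plane i j theta2 = \sum_(t < n) plane i j 'X_t * c t.
  by rewrite /theta2 rmorph_sum; apply: eq_bigr => t _; rewrite /= planeM rmorph_sum.
rewrite (bigD1 i) //= (bigD1 j) /=; last by rewrite eq_sym.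
rewrite big1 => [|t /andP[ti tj]]; last by rewrite planeX0 // mul0r.
rewrite addr0 planeXl // planeXr // /c.
have sumE (v w : 'I_n) : v != w ->
    (forall t, t != v -> t != w -> plane i j ('X_t : S) = 0) ->
    \sum_(u < n | (u < v)%N) plane i j ('X_u : S) = if (w < v)%N then plane i j ('X_w : S) else 0.
  move=> vw h0; case: ifP => wv.
    rewrite (bigD1 w) //= big1 ?addr0 // => t /andP[tv tw]; apply: h0 => //.
    by apply: contraTneq tv => ->; rewrite ltnn.
  rewrite big1 // => t tv; apply: h0; first by apply: contraTneq tv => ->; rewrite ltnn.
  by apply: contraTneq tv => ->; rewrite wv.
rewrite (sumE i j) //; last exact: planeX0.
rewrite (sumE j i); [|by rewrite eq_sym|by move=> t tj ti; apply: planeX0].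
rewrite planeXl // planeXr //.
have : (i != j :> nat) by [].
by rewrite neq_ltn => /orP[h|h]; rewrite h (leq_gtF (ltnW h)); ring.
Qed.

Lemma plane_subst (i j : 'I_n) phi x :
  plane i j (subst_poly phi x) = (map_poly (polyC \o polyC) phi).[plane i j x].
Proof.
rewrite /subst_poly -horner_map /= -map_poly_comp; congr (_.[_]).
by apply: eq_map_poly => c; rewrite /= planeC.
Qed.

Lemma plane_subst_theta1 (i j : 'I_n) phi : i != j ->
  plane i j (subst_poly phi theta1) = phi%:P.
Proof.
move=> ij; rewrite plane_subst plane_theta1 // map_poly_comp /= horner_map.
by rewrite -/(phi \Po 'X) comp_polyXr.
Qed.

(** In the coordinates s, y the restriction of [theta2] is s y - y^2, with leading coefficient -1 in
    y; substituting it into a monic polynomial gives a power of -1. *)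
Lemma lead_coef_plane_theta2 (i j : 'I_n) psi : i != j -> psi \is monic ->
  lead_coef (plane i j (subst_poly psi theta2)) \is a GRing.unit.
Proof.
move=> ij psi1; rewrite plane_subst plane_theta2 //.
set w : {poly {poly k}} := _ * 'X.
have sw : size (('X : {poly k})%:P - 'X : {poly {poly k}}) = 2.
  by rewrite -opprB size_polyN size_XsubC.
have lw : lead_coef w = -1.
  rewrite /w lead_coefM lead_coefX mulr1 -opprB lead_coefN.
  by rewrite (monicP (monicXsubC _)).
rewrite map_poly_comp -/((map_poly polyC psi) \Po w).
rewrite lead_coef_comp; last by rewrite /w size_mulX ?sw // -size_poly_eq0 sw.
rewrite lw lead_coef_map (monicP psi1) rmorph1 mul1r unitrX //.
by rewrite unitrN unitr1.
Qed.

Lemma axis_subst_theta1 i phi : axis i (subst_poly phi theta1) = phi.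
Proof.
rewrite /subst_poly -horner_map /= -map_poly_comp.
have -> : axis i theta1 = 'X.
  rewrite /theta1 rmorph_sum (bigD1 i) //= big1 => [|t ti].
    by rewrite addr0 /axis mmapX mmap1U eqxx.
  by rewrite /axis mmapX mmap1U (negPf ti).
rewrite -[RHS]comp_polyXr /comp_poly; congr (_.[_]).
by apply: eq_map_poly => c; rewrite /= /axis mmapC.
Qed.

Variable G : rel 'I_n.
Hypothesis hG : simple_graph G.
Hypothesis close : forall s t, s != t -> G s t \/ exists u, G s u /\ G u t.

(** On every plane the first element becomes a non-zero polynomial in the inner variable, and the
    second has unit leading coefficient in the outer one. Regularity thus holds edge by edge, and
    [glue] assembles the local quotients into one. *)
Lemma theta_weakly_regular phi psi : phi != 0 -> psi \is monic ->
  weakly_regular (symbolic_power k G 2) [:: subst_poly phi theta1; subst_poly psi theta2].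
Proof.
move=> phi0 psi1; set f := subst_poly phi _; set g := subst_poly psi _.
have fe i j : G i j -> plane i j f != 0.
  by move=> /(edge_neq hG) ij; rewrite plane_subst_theta1 // polyC_eq0.
split=> /= [b /symbolic_squareP h|].
  apply/symbolic_squareP => i j Gij.
  exact: (edge_square_regular (edge_neq hG Gij) (fe _ _ Gij) (h _ _ Gij)).
split=> // b [c [y [/symbolic_squareP hy e]]].
have dex i j : exists d, G i j -> edge_square i j (b - f * d).
  have [Gij|nG] := boolP (G i j); last by exists 0 => Gij; case/negP: nG.
  have ij := edge_neq hG Gij.
  have [||d hd] := @edge_square_regular2 k n i j f g b c ij (fe _ _ Gij).
  - move=> u v; rewrite [plane i j f]plane_subst_theta1 //.
    by apply: monic_regular_mod_const => //; apply: lead_coef_plane_theta2.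
  - have -> : g * b - f * c = y by rewrite e; ring.
    exact: hy.
  by exists d.
have [d hd] : exists d : 'I_n -> 'I_n -> S, forall i j, G i j -> edge_square i j (b - f * d i j).
  have /choice[d hd] i : exists d : 'I_n -> S, forall j, G i j -> edge_square i j (b - f * d j).
    by have [d hd] := choice (dex i); exists d.
  by exists d.
have [||d0 h0] := @glue k n G hG close f b d => //.
  by move=> i; rewrite axis_subst_theta1.
by exists d0, (b - f * d0); split=> //; ring.
Qed.
End Theta.

(** * Diameter at most two *)

Lemma maximal_ideal_inverse (R : comNzRingType) (M : prime_idealr R) (z : R) :
  maximal_ideal (M : idealr R) -> z \notin (M : pred R) ->
  exists w, z * w - 1 \in (M : pred R).
Proof.
move=> maxM zM; pose A := add_gen [set x | x \in (M : pred R)] z.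
have idM := idealr_is_ideal (M : idealr R).
have idA : is_ideal A by apply: is_ideal_add_gen.
have [[c [y [/= My e]]]|A1] := pselect (A 1).
  exists c; rewrite e opprD addrA [z * c]mulrC subrr sub0r.
  by apply: (is_idealN idM).
case/negP: zM; apply: (maxM (idealr_of idA A1)).
  by move=> x Mx; rewrite mem_idealr_of; apply/asboolP/sub_add_gen.
by rewrite mem_idealr_of; apply/asboolP/mem_add_gen.
Qed.

Section CohenMacaulayDirection.
Variables (k : fieldType) (n : nat) (G : rel 'I_n).
Local Notation S := {mpoly k[n]}.
Implicit Types (i j t : 'I_n).
Hypothesis hG : simple_graph G.

(** Otherwise each edge prime has an element outside [N]; the product of the squares of these
    elements lies in the symbolic square but not in [N]. *)
Lemma prime_contains_edge (N : set S) : is_ideal N -> ~ N 1 ->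
  (forall x y, N (x * y) -> N x \/ N y) -> symbolic_power k G 2 `<=` N ->
  exists i j, G i j /\ edge_prime k i j `<=` N.
Proof.
move=> [_ _ NM] N1 Npr IN; apply: contrapT => no.
have f_ex (e : 'I_n * 'I_n) : exists f, ~ N f /\ (G e.1 e.2 -> edge_prime k e.1 e.2 f).
  have [Ge|nG] := boolP (G e.1 e.2); last by exists 1; split=> // Ge; case/negP: nG.
  apply: contrapT => h; apply: no; exists e.1, e.2; split=> // f hf.
  by apply: contrapT => nf; apply: h; exists f.
have [f fP] := choice f_ex.
have nNM x y : ~ N x -> ~ N y -> ~ N (x * y) by move=> hx hy /Npr [].
have : ~ N (\prod_e (f e * f e)).
  by apply: (big_ind (fun x => ~ N x)) => // e _; have [h _] := fP e; apply: nNM.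
apply; apply/IN/(symbolic_squareP) => i j Gij.
have [_ hf] := fP (i, j); rewrite (bigD1 (i, j)) //= mulrC.
have [_ _ PM] := edge_square_ideal k i j.
by apply: (PM); apply: edge_squareM; apply: hf.
Qed.

Section AtMaximalIdeal.
Variables (J : idealr S) (M : prime_idealr {ideal_quot J}).
Hypothesis JE : [set x | x \in (J : pred S)] = symbolic_power k G 2.
Hypothesis maxM : maximal_ideal (M : idealr {ideal_quot J}).

Let loc := localizes_to_loc M.

(** The smallest prime of the chain contracts to a prime containing some edge prime, modulo which
    three elements are algebraically dependent because the plane ring has only two variables. *)
Lemma no_prime_chain_at (p : nat -> prime_idealr (localization M)) d :
  prime_chain p d -> (d <= 2)%N.
Proof.
move=> chp; rewrite leqNgt; apply/negP => d3.
have ch3 : prime_chain p 3 by move=> i i3; apply: chp; apply: leq_trans d3.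
pose phi : {rmorphism S -> localization M} := to_loc M.
apply: (@no_prime_chain3 k _ (phi \o mpolyC n (R := k)) p ch3) => a0 a1 a2 _ _ _.
have [||||i [j [Gij PN]]] := @prime_contains_edge [set x | phi x \in (p 0%N : pred _)].
- split=> /=; first by rewrite rmorph0 idealr0.
    by move=> x y hx hy; rewrite rmorphD rpredD.
  by move=> a x hx; rewrite rmorphM idealMr.
- by rewrite /= rmorph1 idealr1.
- by move=> x y /=; rewrite rmorphM prime_idealrM => /orP.
- rewrite -JE => x Jx /=; have -> : phi x = 0; last exact: idealr0.
  apply/(loc_zero loc); exists 1; split; first exact: loc_proper loc.
  by rewrite mul1r.
have [b0 [q0 [Nq0 e0]]] := loc_frac loc a0; have [v0 vq0] := loc_unit loc Nq0.
have [b1 [q1 [Nq1 e1]]] := loc_frac loc a1; have [v1 vq1] := loc_unit loc Nq1.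
have [b2 [q2 [Nq2 e2]]] := loc_frac loc a2; have [v2 vq2] := loc_unit loc Nq2.
(* These units clear denominators, so a relation between the numerators is enough. *)
exists (phi q0), (phi q1), (phi q2).
have [N [c [c0 hc]]] := algebraic_dependence (plane i j b0) (plane i j b1) (plane i j b2).
exists N, c; split=> //; first by exists v0, v1, v2.
rewrite ![phi _ * _]mulrC e0 e1 e2.
have ij := edge_neq hG Gij.
pose z : S := \sum_x (c x)%:MP * (b0 ^+ x.1.1 * b1 ^+ x.1.2 * b2 ^+ x.2).
have hz : edge_prime k i j z.
  apply/(edge_primeP ij); rewrite -[RHS]hc rmorph_sum; apply: eq_bigr => x _ /=.
  by rewrite !planeM planeC !rmorphXn.
suff <- : phi z = \sum_x (phi \o mpolyC n (R := k)) (c x) *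
    (phi b0 ^+ x.1.1 * phi b1 ^+ x.1.2 * phi b2 ^+ x.2) by exact: (PN z hz).
by rewrite rmorph_sum; apply: eq_bigr => x _; rewrite !rmorphM !rmorphXn.
Qed.

Definition residue : {rmorphism S -> {ideal_quot M}} := quot_map M \o quot_map J.

Lemma residueD : {morph residue : x y / x + y}. Proof. exact: rmorphD. Qed.

Lemma residueM : {morph residue : x y / x * y}. Proof. exact: rmorphM. Qed.

Lemma residue_eq0 x : residue x = 0 <-> contracted M x.
Proof. exact: quot_map_eq0. Qed.

Lemma residue_surj z : exists x, residue x = z.
Proof.
exists (repr (repr z)).
by rewrite -[residue _]/(quot_map M (quot_map J (repr (repr z)))) /quot_map !reprK.
Qed.

Lemma residue_inverse (z : {ideal_quot M}) : z != 0 -> exists w, z * w = 1.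
Proof.
have zE : quot_map M (repr z) = z by rewrite /quot_map reprK.
move=> z0; have [|w hw] := @maximal_ideal_inverse _ M (repr z) maxM.
  by apply/negP => /quot_map_eq0 h; move: z0; rewrite -zE h eqxx.
exists (quot_map M w); apply/eqP; rewrite -subr_eq0 -{1}zE -(rmorph1 (quot_map M)) -rmorphM
  -rmorphB.
exact/eqP/quot_map_eq0.
Qed.

Definition residue_const : {rmorphism k -> {ideal_quot M}} := residue \o mpolyC n (R := k).

(** The residue field is generated over [k] by the classes of x_i and x_j, so [zariski_two] gives a
    non-zero polynomial vanishing at x_i, which is then made monic. *)
Lemma residue_coord_integral i j : i != j -> edge_prime k i j `<=` contracted M ->
  integralOver residue_const (residue 'X_i).
Proof.
move=> ij PN; have cm : commr_rmorph residue_const (residue 'X_i) by move=> c; apply: mulrC.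
pose rho : {rmorphism {poly k} -> {ideal_quot M}} := horner_morph cm.
have [||phi [phi0 hphi]] := @zariski_two k _ rho (residue 'X_j).
- exact: residue_inverse.
- move=> z; have [f <-] := residue_surj z.
  elim/mpoly_subring_ind: f => [c|t|f g [p fE] [q gE]|f g [p fE] [q gE]].
  + exists c%:P%:P; rewrite map_polyC hornerC.
    exact: (esym (horner_morphC cm c)).
  + have [->|ti] := eqVneq t i.
      by exists ('X)%:P; rewrite map_polyC hornerC; exact: (esym (horner_morphX cm)).
    have [->|tj] := eqVneq t j; first by exists 'X; rewrite map_polyX hornerX.
    exists 0; rewrite rmorph0 horner0; apply/residue_eq0/PN; exact: edge_primeX.
  + by exists (p + q); rewrite residueD fE gE rmorphD hornerD.
  + by exists (p * q); rewrite residueM fE gE rmorphM hornerM.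
exists ((lead_coef phi)^-1 *: phi).
  by rewrite monicE lead_coefZ mulVf // lead_coef_eq0.
rewrite /root map_polyZ hornerZ; have : (map_poly residue_const phi).[residue 'X_i] = 0 by [].
by move=> ->; rewrite mulr0.
Qed.

Lemma residue_integral i j x : i != j -> edge_prime k i j `<=` contracted M ->
  integralOver residue_const (residue x).
Proof.
move=> ij PN; elim/mpoly_subring_ind: x => [c|t|x y hx hy|x y hx hy].
- exact: integral_id.
- have [->|ti] := eqVneq t i; first exact: residue_coord_integral PN.
  have [->|tj] := eqVneq t j.
    apply: (@residue_coord_integral j i); first by rewrite eq_sym.
    move=> f hf; apply: PN; apply: ideal_gen_sub hf => y [u [uj ui ->]].
    by exists u.
  have -> : residue 'X_t = 0 by apply/residue_eq0/PN; apply: edge_primeX.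
  exact: integral0.
- rewrite residueD; exact: (integral_add hx hy).
- rewrite residueM; exact: (integral_mul hx hy).
Qed.

Lemma exists_monic_at i j x : i != j -> edge_prime k i j `<=` contracted M ->
  exists phi : {poly k}, phi \is monic /\ contracted M (subst_poly phi x).
Proof.
move=> ij PN; have [phi phi1 hphi] := residue_integral x ij PN.
exists phi; split=> //; apply/residue_eq0.
rewrite /subst_poly -(horner_map residue) -(map_poly_comp residue).
exact/eqP/hphi.
Qed.

Hypothesis close : forall s t, s != t -> G s t \/ exists u, G s u /\ G u t.

Lemma cohen_macaulay_at : cohen_macaulay_local (localization M).
Proof.
have [i [j [Gij PN]]] : exists i j, G i j /\ edge_prime k i j `<=` contracted M.
  apply: prime_contains_edge; [exact: loc_prime_ideal loc|exact: loc_proper loc|exact: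
    loc_prime loc|].
  by rewrite -JE; apply: loc_sub loc.
have ij := edge_neq hG Gij.
have [phi [phi1 Nphi]] := exists_monic_at (theta1 k n) ij PN.
have [psi [psi1 Npsi]] := exists_monic_at (theta2 k n) ij PN.
apply: (@localizes_cohen_macaulay _ _ _ _ _ [:: subst_poly phi (theta1 k n);
  subst_poly psi (theta2 k n)] loc).
- exact: ideals_fg_mpoly.
- rewrite JE; apply: theta_weakly_regular => //; exact: monic_neq0.
- by move=> x; rewrite !inE => /orP[] /eqP ->.
exact: no_prime_chain_at.
Qed.

End AtMaximalIdeal.

Lemma symbolic_square_cohen_macaulay :
  (forall s t, s != t -> G s t \/ exists u, G s u /\ G u t) -> (exists i j, G i j) ->
  cohen_macaulay_ideal (symbolic_power k G 2).
Proof.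
move=> close [i [j Gij]].
have I1 : ~ symbolic_power k G 2 1.
  move=> /symbolic_squareP /(_ i j Gij) /(edge_square_derivP (edge_neq hG Gij))[+ _].
  by rewrite rmorph1 => /eqP; rewrite oner_eq0.
exists (idealr_of (is_ideal_symbolic_square k G) I1).
have JE : [set x | x \in (idealr_of (is_ideal_symbolic_square k G) I1 : pred S)] =
    symbolic_power k G 2.
  by apply/seteqP; split=> x /= h; apply/asboolP.
split=> //; split=> [|M maxM]; last exact: cohen_macaulay_at.
by apply/ideals_fg_noetherian/ideals_fg_quot/ideals_fg_mpoly.
Qed.

End CohenMacaulayDirection.

(** * Diameter greater than two *)

Section Converse.
Variables (k : fieldType) (n : nat) (G : rel 'I_n).
Local Notation S := {mpoly k[n]}.
Implicit Types (i j t u v : 'I_n).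
Hypothesis hG : simple_graph G.

Definition irrelevant : set S := [set f | f@_0%MM = 0].

Lemma mcoeff0M (f g : S) : (f * g)@_0%MM = f@_0%MM * g@_0%MM.
Proof. exact: rmorphM (mcoeff 0%MM) f g. Qed.

Lemma is_ideal_irrelevant : is_ideal irrelevant.
Proof.
split; rewrite /irrelevant /=; first by rewrite mcoeff0.
  by move=> f g hf hg; rewrite mcoeffD hf hg addr0.
by move=> a f hf; rewrite mcoeff0M hf mulr0.
Qed.

Lemma irrelevantX t : irrelevant 'X_t.
Proof. by rewrite /irrelevant /= mcoeffX mnm1_eq0. Qed.

Lemma irrelevant_min (A : set S) : is_ideal A -> (forall t, A 'X_t) -> irrelevant `<=` A.
Proof.
move=> idA hA f f0; rewrite (mpolyE f); apply: is_ideal_sum => // m.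
rewrite mcoeff_msupp => fm; have [_ _ AM] := idA.
have [t mt] : exists t, m t != 0%N.
  apply: contrapT => no; move/eqP: fm; apply; have -> : m = 0%MM; last by [].
  apply/mnmP => t; rewrite mnm0E; apply/eqP; apply: contrapT => /negP mt.
  by apply: no; exists t.
have -> : m = (m - U_(t) + U_(t))%MM by rewrite submK // lep1mP.
by rewrite mpolyXD -mul_mpolyC; apply: (AM); apply: (AM).
Qed.

Lemma edge_prime_irrelevant i j : edge_prime k i j `<=` irrelevant.
Proof.
apply: ideal_gen_min; first exact: is_ideal_irrelevant.
by move=> _ [t [_ _ ->]]; apply: irrelevantX.
Qed.

Lemma edge_square_prime i j : edge_square (k := k) i j `<=` edge_prime k i j.
Proof.
apply: edge_square_sub; first exact: edge_prime_ideal.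
by move=> f g _ hg; have [_ _] := edge_prime_ideal k i j; apply.
Qed.

(** Localized at the origin, this sequence produces a chain of three primes, so the dimension there
    is at least 2. *)
Lemma edge_plane_regular i j : i != j ->
  weakly_regular (edge_prime k i j) [:: 'X_i + 'X_j; 'X_j].
Proof.
move=> ij.
have plane_sum : plane i j ('X_i + 'X_j : S) = ('X : {poly k})%:P.
  by rewrite planeD planeXl // planeXr // subrK.
split=> [b|/=].
  move=> /(edge_primeP ij); rewrite planeM plane_sum => /eqP.
  rewrite mulf_eq0 polyC_eq0 polyX_eq0 /= => /eqP b0.
  exact/(edge_primeP ij).
split=> // b [c [y [/(edge_primeP ij) y0 e]]].
have [|||d dE] := @monic_regular_mod_const k 'X (plane i j 'X_j) (plane i j b) (plane i j c).
- by rewrite polyX_eq0.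
- by rewrite planeXr // lead_coefX unitr1.
- by rewrite -planeM e planeD planeM plane_sum y0 addr0 mulrC.
exists (plane_lift i j d), (b - ('X_i + 'X_j) * plane_lift i j d); split; last by ring.
by apply/(edge_primeP ij); rewrite planeB planeM plane_sum plane_liftK // dE subrr.
Qed.

Variables (s t : 'I_n).
Hypothesis st : s != t.
Hypothesis nGst : ~~ G s t.
Hypothesis no_common : forall u, ~~ (G s u && G u t).

Let symG : symmetric G. Proof. by case: hG. Qed.

Lemma symbolic_square_irrelevant : symbolic_power k G 2 `<=` irrelevant.
Proof.
have [_ _ /(_ s)[v Gsv]] := hG.
move=> f /symbolic_squareP /(_ _ _ Gsv) /edge_square_prime.
exact: edge_prime_irrelevant.
Qed.

(* l represents the section of S / I on the punctured spectrum equal to       *)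
(* h x_s x_t on the edges at s and to 0 on the others.                        *)
Definition represents (h l : S) : Prop :=
  forall i j, G i j ->
    (((s == i) || (s == j)) -> edge_square i j (l - h * ('X_s * 'X_t))) /\
    (~~ ((s == i) || (s == j)) -> edge_square i j l).

Lemma edge_square_monomial i j m : (1 < weight i j m)%N -> edge_square (k := k) i j 'X_[m].
Proof.
move=> h; apply/edge_square_weightP => m' w; rewrite mcoeffX.
by case: eqVneq => // mm; move: h; rewrite mm ltnNge w.
Qed.

Lemma weight_mnm1 i j u : weight i j U_(u)%MM = (u != i) && (u != j) :> nat.
Proof.
have [h|h] := boolP ((u != i) && (u != j)).
  rewrite /weight (bigD1 u) //= mnm1E eqxx big1 // => v /andP[_ vu].
  by rewrite mnm1E eq_sym (negPf vu).
rewrite /weight big1 // => v hv; rewrite mnm1E.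
by case: eqVneq => // uv; move: h; rewrite uv hv.
Qed.

(** If [u] is [s] or a neighbour of [s], the product x_u x_s x_t works: an edge avoiding [s] cannot
    contain both [u] and [t], which are neither equal nor adjacent when [u] is a neighbour of [s].
    Otherwise 0 works, since [u] and [t] are both off every edge at [s]. *)
Lemma represents_coord u : exists l, represents 'X_u l.
Proof.
have XE : 'X_u * ('X_s * 'X_t) = 'X_[U_(u) + (U_(s) + U_(t))] :> S by rewrite !mpolyXD.
have [hu|hu] := boolP ((u == s) || G s u).
  exists ('X_u * ('X_s * 'X_t)) => i j Gij; split=> [_|].
    by rewrite subrr; case: (edge_square_ideal k i j).
  rewrite negb_or => /andP[si sj]; rewrite XE; apply: edge_square_monomial.
  rewrite !weightD !weight_mnm1 si sj /=.
  case/predU1P: hu => [->|Gsu]; first by rewrite si sj.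
  suff : ((u != i) && (u != j)) || ((t != i) && (t != j)) by case/orP=> ->; lia.
  apply: contraT; rewrite negb_or !negb_and !negbK => /andP[uij tij].
  have ut : u != t by apply: contraNneq nGst => <-.
  have := no_common u; rewrite Gsu /=.
  case/orP: uij => /eqP uE; case/orP: tij => /eqP tE; rewrite uE tE ?Gij //.
  - by move: ut; rewrite uE tE eqxx.
  - by rewrite symG Gij.
  - by move: ut; rewrite uE tE eqxx.
exists 0 => i j Gij; split=> [sij|_]; last by case: (edge_square_ideal k i j).
rewrite sub0r; apply: (is_idealN (edge_square_ideal k i j)).
rewrite XE; apply: edge_square_monomial; rewrite !weightD !weight_mnm1.
move: hu; rewrite negb_or => /andP[us nGsu].
have Gji : G j i by rewrite symG.
have far x : x != s -> ~~ G s x -> (x != i) && (x != j).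
  move=> xs nGsx; apply/andP; split; apply/eqP => xE; move: xs nGsx;
    by case/orP: sij => /eqP ->; rewrite xE ?eqxx ?Gij ?Gji.
have ts : t != s by rewrite eq_sym.
by rewrite (far u) // (far t) // addnCA leq_addl.
Qed.

Lemma represents_exists h : irrelevant h -> exists l, represents h l.
Proof.
apply: (@irrelevant_min [set h | exists l, represents h l]); last exact: represents_coord.
split=> /=.
- exists 0 => i j Gij; rewrite mul0r subrr.
  by split=> _; case: (edge_square_ideal k i j).
- move=> x y [l hl] [l' hl']; exists (l + l') => i j Gij.
  have [_ PD _] := edge_square_ideal k i j.
  have [h1 h2] := hl _ _ Gij; have [h3 h4] := hl' _ _ Gij.
  split=> sij; last by apply: (PD); [apply: h2|apply: h4].
  have -> : l + l' - (x + y) * ('X_s * 'X_t) =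
    (l - x * ('X_s * 'X_t)) + (l' - y * ('X_s * 'X_t)) by ring.
  by apply: (PD); [apply: h1|apply: h3].
- move=> a x [l hl]; exists (a * l) => i j Gij.
  have [_ _ PM] := edge_square_ideal k i j; have [h1 h2] := hl _ _ Gij.
  split=> sij; last by apply: (PM); apply: h2.
  have -> : a * l - a * x * ('X_s * 'X_t) = a * (l - x * ('X_s * 'X_t)) by ring.
  by apply: (PM); apply: h1.
Qed.

(** Both products represent [g * h] times the same section. *)
Lemma represents_cross g h lg lh : represents g lg -> represents h lh ->
  symbolic_power k G 2 (g * lh - h * lg).
Proof.
move=> hg hh; apply/symbolic_squareP => i j Gij.
have idE := edge_square_ideal k i j; have [_ _ PM] := idE.
have [h1 h2] := hg _ _ Gij; have [h3 h4] := hh _ _ Gij.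
have [sij|sij] := boolP ((s == i) || (s == j)).
  have -> : g * lh - h * lg =
    g * (lh - h * ('X_s * 'X_t)) - h * (lg - g * ('X_s * 'X_t)) by ring.
  by apply: (is_idealB idE); apply: (PM); [apply: h3|apply: h1].
by apply: (is_idealB idE); apply: (PM); [apply: h4|apply: h2].
Qed.

(* The represented section is not a fraction p / w: at x_s^2 x_t its edges at *)
(* s force the coefficient of x_s x_t in p to be w(0), at x_s x_t^2 its edges *)
(* at t force it to be 0.                                                     *)
Lemma represents_not_fraction ls lt w p :
  represents 'X_s ls -> represents 'X_t lt -> ~ irrelevant w ->
  symbolic_power k G 2 (w * ls - 'X_s * p) -> ~ symbolic_power k G 2 (w * lt - 'X_t * p).
Proof.
move=> hs ht w0 /symbolic_squareP Is /symbolic_squareP It; apply: w0.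
have [_ irrG nbr] := hG.
have [v Gsv] := nbr s; have [v' Gtv] := nbr t.
pose m := (U_(s) + U_(t))%MM.
have Xm : 'X_s * 'X_t = 'X_[m] :> S by rewrite mpolyXD.
have vt : v != t by apply: contraNneq nGst => <-.
have sv' : s != v' by apply: contraNneq nGst => ->; rewrite symG.
transitivity (p@_m).
  have [/(_ _)hs1 _] := hs _ _ Gsv.
  have idE := edge_square_ideal k s v; have [_ PD PM] := idE.
  have : edge_square s v ('X_s * (w * 'X_[m] - p)).
    have -> : 'X_s * (w * 'X_[m] - p) = (w * ls - 'X_s * p) - w * (ls - 'X_s * ('X_s * 'X_t)).
      by rewrite Xm; ring.
    by apply: (is_idealB idE); [apply: Is|apply: (PM); apply: hs1; rewrite eqxx].
  move=> /edge_square_weightP /(_ (U_(s) + m)%MM).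
  rewrite !weightD !weight_mnm1 eqxx (eq_sym t s) (negPf st) /= (eq_sym t v) vt.
  move=> /(_ isT); rewrite mulrC mcoeffMX mcoeffB.
  have := mcoeffMX w m 0%MM; rewrite addm0 => ->.
  by move/eqP; rewrite subr_eq0 => /eqP.
have [_ ht2] := ht _ _ Gtv.
have idE := edge_square_ideal k t v'; have [_ PD PM] := idE.
have : edge_square t v' ('X_t * p).
  have -> : 'X_t * p = w * lt - (w * lt - 'X_t * p) by ring.
  apply: (is_idealB idE); [apply: (PM); apply: ht2|exact: It].
  by rewrite negb_or st sv'.
move=> /edge_square_weightP /(_ (U_(t) + m)%MM).
rewrite !weightD !weight_mnm1 eqxx st sv' /=.
by move=> /(_ isT); rewrite mulrC mcoeffMX.
Qed.

Variables (T : comNzRingType) (phi : {rmorphism S -> T}).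
Hypothesis loc : localizes phi (symbolic_power k G 2) irrelevant.

(** A polynomial with non-zero constant term vanishes on no edge plane, hence is regular on each S /
    P_e^2. So S / I embeds in its local ring at the origin. *)
Lemma symbolic_square_regular (w f : S) : ~ irrelevant w ->
  symbolic_power k G 2 (w * f) -> symbolic_power k G 2 f.
Proof.
move=> w0 /symbolic_squareP h; apply/symbolic_squareP => i j Gij.
have ij := edge_neq hG Gij.
apply: (edge_square_regular ij _ (h _ _ Gij)); apply/eqP => hw; apply: w0.
by apply: (@edge_prime_irrelevant i j); apply/(edge_primeP ij).
Qed.

(** Let sigma be the section represented at [h = 1]. Up to units, a sigma and b sigma lie in [T],
    and b (a sigma) = a (b sigma). Regularity of [b] modulo [a] makes a sigma a multiple of [a];
    cancelling [a] exhibits sigma as a fraction, against [represents_not_fraction]. *)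
Lemma no_regular_pair a b : a \in (loc_max loc : pred T) -> b \in (loc_max loc : pred T) ->
  (forall z, a * z = 0 -> z = 0) ->
  ~ (forall z, add_gen [set 0] a (b * z) -> add_gen [set 0] a z).
Proof.
move=> /mem_loc_max[al [q [Nq aq N_al]]] /mem_loc_max[be [r [Nr br N_be]]] reg_a reg_b.
have [la hla] := represents_exists N_al; have [lb hlb] := represents_exists N_be.
have [v vr] := loc_unit loc Nr.
have phi0 f : symbolic_power k G 2 f -> phi f = 0.
  by move=> If; apply/(loc_zero loc); exists 1; rewrite mul1r; split=> //; apply: loc_proper loc.
have phi_inj f : phi f = 0 -> symbolic_power k G 2 f.
  by move=> /(loc_zero loc)[u [Nu]]; apply: symbolic_square_regular.
have cross g h lg lh : represents g lg -> represents h lh -> phi g * phi lh = phi h * phi lg.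
  move=> hg hh; apply/eqP; rewrite -subr_eq0 -!rmorphM -rmorphB; apply/eqP/phi0.
  exact: represents_cross.
have [|c [y [/= -> laE]]] := reg_b (phi la).
  exists (v * phi q * phi lb), 0; split=> //; rewrite addr0.
  transitivity (v * (b * phi r) * phi la); first by rewrite mulrCA -[LHS]mul1r -vr; ring.
  rewrite br -mulrA -(cross _ _ _ _ hla hlb) -aq; ring.
rewrite addr0 in laE.
have [p [w [Nw cw]]] := loc_frac loc c.
(* Here [c] equals [phi q] times sigma and also [p / w], so [p] is [q * w] times sigma; multiplying
   by x_u expresses this inside [S], after cancelling [a]. *)
have key u lu : represents 'X_u lu -> symbolic_power k G 2 (q * w * lu - 'X_u * p).
  move=> hu; apply/phi_inj/reg_a; rewrite rmorphB !rmorphM -cw mulrBr.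
  have -> : a * (phi q * phi w * phi lu) = phi w * ((a * phi q) * phi lu) by ring.
  by rewrite aq (cross _ _ _ _ hla hu) laE; ring.
have [ls hls] := represents_coord s; have [lt hlt] := represents_coord t.
exact: (represents_not_fraction hls hlt (loc_notinM loc Nq Nw) (key _ _ hls) (key _ _ hlt)).
Qed.

(** The plane of an edge at [s] gives dimension at least 2, so equality with the depth would provide
    a regular sequence whose first two elements contradict [no_regular_pair]. *)
Lemma not_cohen_macaulay_local : ~ cohen_macaulay_local T.
Proof.
move=> [_ [M1 [_ [d [[[sq [[reg sub] sd]] _] [_ dim]]]]]].
have [_ _ /(_ s)[v Gsv]] := hG; have sv := edge_neq hG Gsv.
have d2 : (2 <= d)%N.
  have IP : symbolic_power k G 2 `<=` edge_prime k s v.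
    by move=> f /symbolic_squareP /(_ _ _ Gsv) /edge_square_prime.
  have [||||p chp] := @regular_sequence_prime_chain _ (extended phi irrelevant (edge_prime k s v))
      (map phi [:: 'X_s + 'X_v; 'X_v]) (loc_max loc).
  - exact/(is_ideal_extended loc)/edge_prime_ideal.
  - move=> z [f [q [Nq e Pf]]]; apply/mem_loc_max; exists f, q; split=> //.
    exact: edge_prime_irrelevant Pf.
  - move=> z /mapP[f hf ->]; apply/(mem_loc_max loc)/(extended_prime_mem loc).
    move: hf; rewrite !inE => /orP[] /eqP ->; last exact: irrelevantX.
    by case: is_ideal_irrelevant => _ ID _; apply: ID; apply: irrelevantX.
  - apply: (weakly_regular_extended loc) => //; first exact: edge_prime_ideal.
    exact: edge_plane_regular.
  exact: (dim p).
case: sq reg sub sd => [|a [|b sq]] reg sub sd; rewrite /= in sd; [lia|lia|].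
have [reg_a [reg_b _]] := regular_sequence_weakly reg.
apply: (@no_regular_pair a b) => //.
- by apply: (sub_loc_max loc); apply: sub; rewrite mem_head.
- by apply: (sub_loc_max loc); apply: sub; rewrite !inE eqxx orbT.
Qed.

End Converse.

Section IrrelevantMaximal.
Variables (k : fieldType) (n : nat) (J : idealr {mpoly k[n]}).
Hypothesis J0 : forall f, f \in (J : pred _) -> irrelevant f.

Definition irrelevant_quot : set {ideal_quot J} := [set z | irrelevant (repr z)].

Lemma irrelevant_quot_map f : irrelevant_quot (quot_map J f) <-> irrelevant f.
Proof.
have : irrelevant (repr (quot_map J f) - f).
  by apply/J0/quot_map_eq0; rewrite rmorphB /= /quot_map reprK subrr.
rewrite /irrelevant_quot /irrelevant /= mcoeffB => /eqP; rewrite subr_eq0 => /eqP ->.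
by [].
Qed.

Lemma quot_map_repr z : quot_map J (repr z) = z. Proof. by rewrite /quot_map reprK. Qed.

Lemma is_ideal_irrelevant_quot : is_ideal irrelevant_quot.
Proof.
have [I0 ID IM] := is_ideal_irrelevant k n.
split; first by rewrite -(rmorph0 (quot_map J)); apply/irrelevant_quot_map.
  move=> x y hx hy; rewrite -(quot_map_repr x) -(quot_map_repr y) -rmorphD.
  by apply/irrelevant_quot_map/ID.
move=> a x hx; rewrite -(quot_map_repr a) -(quot_map_repr x) -rmorphM.
by apply/irrelevant_quot_map/IM.
Qed.

Lemma irrelevant_quot1 : ~ irrelevant_quot 1.
Proof.
rewrite -(rmorph1 (quot_map J)) irrelevant_quot_map /irrelevant /= mcoeff1 eqxx.
by apply/eqP; rewrite oner_eq0.
Qed.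

Lemma irrelevant_quot_prime x y : irrelevant_quot (x * y) -> irrelevant_quot x \/
  irrelevant_quot y.
Proof.
rewrite -(quot_map_repr x) -(quot_map_repr y) -rmorphM !irrelevant_quot_map.
rewrite /irrelevant /= mcoeff0M => /eqP; rewrite mulf_eq0 => /orP[] /eqP; by [left|right].
Qed.

Definition irrelevant_max : prime_idealr {ideal_quot J} :=
  prime_idealr_of is_ideal_irrelevant_quot irrelevant_quot1 irrelevant_quot_prime.

(** An element outside has non-zero constant term [c]. A larger ideal containing it also contains
    the class of [c], which is a unit. *)
Lemma maximal_irrelevant_max : maximal_ideal (irrelevant_max : idealr _).
Proof.
move=> A MA z zA; rewrite mem_prime_idealr_of; apply/asboolP; apply: contrapT => nz.
pose c := (repr z)@_0%MM.
have c0 : c != 0 by apply/eqP.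
have cA : quot_map J c%:MP \in (A : pred _).
  have -> : quot_map J c%:MP = z - quot_map J (repr z - c%:MP).
    by rewrite rmorphB /= quot_map_repr opprB addrC subrK.
  rewrite rpredB //; apply: MA; rewrite mem_prime_idealr_of; apply/asboolP.
  apply/irrelevant_quot_map; rewrite /irrelevant /= mcoeffB mcoeffC eqxx mulr1.
  exact: subrr.
have := idealr1 A; suff -> : 1 = quot_map J (c^-1)%:MP * quot_map J c%:MP by rewrite idealMr.
by rewrite -rmorphM /= -mpolyCM mulVf // mpolyC1 rmorph1.
Qed.

Lemma contracted_irrelevant_max : contracted irrelevant_max = @irrelevant k n.
Proof.
apply/seteqP; split=> f /= hf; last exact/asboolP/irrelevant_quot_map.
apply/irrelevant_quot_map; exact/asboolP/hf.
Qed.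

End IrrelevantMaximal.

(** * Diameter at most two in terms of common neighbours, and the conclusion *)

Section Diameter.
Variables (n : nat) (G : rel 'I_n).
Hypothesis hG : simple_graph G.

Lemma diam_le2P : xnat_le (diam G) 2 <->
  forall s t, s != t -> G s t \/ exists u, G s u /\ G u t.
Proof.
have [symG irrG _] := hG.
(* A path of length at most 2 between distinct vertices is an edge or passes through a common
   neighbour. *)
have path2 i j d : has_path G i j d -> (d <= 2)%N -> i != j -> G i j \/ exists u, G i u /\ G u j.
  case: d => [|[|[|//]]] /existsP[p /and3P[]].
  - by rewrite (tuple0 p) /= => _ _ /eqP ->; rewrite eqxx.
  - case: p => -[|x [|//]] //= _; rewrite andbT => Gix _ /eqP <- _ _.
    by left.
  - case: p => -[|x [|y [|//]]] //= _; rewrite andbT => /andP[Gix Gxy] _ /eqP <- _ _.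
    by right; exists x.
split=> [|close].
  rewrite /diam; case: ifP => // /forallP fin le2 s t st.
  have [d dE] : exists d, distance G s t = Some d.
    by have /forallP/(_ t) := fin s; case: (distance G s t) => // d _; exists d.
  have d2 : (d <= 2)%N.
    apply: leq_trans le2; apply: (@bigmax_sup _ s) => //; apply: (@bigmax_sup _ t) => //.
    by rewrite dE.
  move: dE; rewrite /distance; case: pselect => // ex [dE]; apply: (path2 s t d) => //.
  by rewrite -dE; case: ex_minnP.
have short i j : exists2 d, has_path G i j d & (d <= 2)%N.
  have [->|ij] := eqVneq i j.
    by exists 0%N => //; apply/existsP; exists [tuple]; rewrite /= eqxx.
  have [Gij|[u [Giu Guj]]] := close _ _ ij.
    by exists 1%N => //; apply/existsP; exists [tuple j]; rewrite /= Gij mem_seq1 ij eqxx.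
  exists 2%N => //; apply/existsP; exists [tuple u; j];
    rewrite /= Giu Guj mem_seq2 mem_seq1 negb_or ij eqxx.
  rewrite !andbT /=; apply/andP; split.
    by apply: contraTneq Giu => ->; rewrite irrG.
  by apply: contraTneq Guj => ->; rewrite irrG.
have dist i j : exists2 d, distance G i j = Some d & (d <= 2)%N.
  have [d hd d2] := short i j; rewrite /distance; case: pselect => [ex|]; last by case; exists d.
  by exists (ex_minn ex) => //; case: ex_minnP => m _ /(_ d hd) md; apply: leq_trans d2.
rewrite /diam ifT; last first.
  by apply/forallP => i; apply/forallP => j; have [d -> _] := dist i j.
apply/bigmax_leqP => i _; apply/bigmax_leqP => j _.
by have [d -> d2] := dist i j.
Qed.

End Diameter.

Unset Implicit Arguments.

Theorem theorem2p3 (k : fieldType) (n : nat) (hn : (3 <= n)%N)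
    (G : rel 'I_n) (hG : simple_graph G) :
  cohen_macaulay_ideal (symbolic_power k G 2) <-> xnat_le (diam G) 2.
Proof.
rewrite (diam_le2P hG); split=> [[J [JE [_ cmJ]]] s t st|close].
  apply: contrapT => /not_orP[/negP nGst no].
  have no_common u : ~~ (G s u && G u t).
    by apply/negP => /andP[Gsu Gut]; apply: no; exists u.
  have J0 f : f \in (J : pred _) -> irrelevant f.
    move=> fJ; apply: (symbolic_square_irrelevant hG s); rewrite -JE; exact: fJ.
  have := localizes_to_loc (irrelevant_max J0).
  rewrite JE contracted_irrelevant_max => loc.
  apply: (not_cohen_macaulay_local hG st nGst no_common loc).
  exact/cmJ/maximal_irrelevant_max.
apply: symbolic_square_cohen_macaulay => //.
(* A vertex exists, hence an edge, which is what makes the symbolic square a proper ideal. *)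
have [_ _ nbr] := hG; pose i := Ordinal (leq_trans (isT : (0 < 3)%N) hn).
by have [j Gij] := nbr i; exists i, j.
Qed.
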